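(* Let $K, K_1,\ldots,K_m$ be simplicial complexes on $[m],[n_1],\ldots,[n_m]$, respectively. Assume that $K$ is connected. Then there is a homotopy equivalence $$K\langle K_1,\ldots,K_m\rangle\;\simeq\; K\vee \bigl(\mathrm{link}_{K^{0}}(v_1)*K_1\bigr)\vee\cdots\vee \bigl(\mathrm{link}_{K^{m-1}}(v_m)*K_m\bigr).$$
   Context: A simplicial complex on $[m]=\{1,\dots,m\}$ is a collection of subsets of $[m]$ closed under taking subsets, containing $\emptyset$, whose vertices are labelled by $[m]$ (so $\{i\}\in K$ for each $i$); the vertices of $K$ are also denoted $v_1,\dots,v_m$. Homotopy statements refer to geometric realizations. $*$ is the join (of simplicial complexes), with $\{\emptyset\}*L=L$. Substitution complex: for $K$ on $[m]$ and $K_i$ on $[n_i]$, the substitution complex $K\langle K_1,\ldots,K_m\rangle$ is the polyhedral join $(K_i,\emptyset)^{*K}$, i.e. the simplicial complex on vertices $v_{i,j}$ ($i\in[m]$, $j\in[n_i]$) whose simplices are exactly the joins (disjoint unions) $\tau_{i_1}*\cdots*\tau_{i_k}$ with $\{i_1,\dots,i_k\}\in K$ and $\tau_{i_j}\in K_{i_j}$, where the vertices of $K_i$ are identified with $v_{i,1},\dots,v_{i,n_i}$. Let $\bullet$ denote the simplicial complex consisting of a single vertex. Define $K^0=K$, $K^1=K\langle K_1,\bullet,\ldots,\bullet\rangle$, and in general $K^{i}=K^{i-1}\langle \underbrace{\bullet,\ldots,\bullet}_{n_1+\cdots+n_{i-1}},K_i,\bullet,\ldots,\bullet\rangle$ for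 $1\le i\le m$, so that $K_i$ is substituted into the vertex $v_i$ (and the vertices coming from $K_1,\dots,K_{i-1}$ are listed first, followed by $v_i,v_{i+1},\dots,v_m$). $K$ is identified with the full subcomplex of the substitution complex on the vertices $v_{1,1},\dots,v_{m,1}$, and $v_i$ is identified with $v_{i,1}$; in particular $v_i$ is a vertex of $K^{i-1}$. For a vertex $v$ of a simplicial complex $K$, $\mathrm{link}_K(v)=\{\tau\in K\mid v\notin\tau,\ \tau\cup\{v\}\in K\}$. *)

(* Defs.v *)
From HB Require Import structures.
From mathcomp Require Import all_boot all_order all_algebra.
From mathcomp Require Import all_classical all_reals topology wedge_sigT.

Set Implicit Arguments.
Unset Strict Implicit.
Unset Printing Implicit Defensive.

Import Order.TTheory GRing.Theory Num.Theory.
Import numFieldTopology.Exports.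

Local Open Scope classical_set_scope.
Local Open Scope ring_scope.

(* A complex on the finite vertex set V is its collection of simplices, a
   (classical) set of finite sets.  The constructions below are defined on
   arbitrary collections; [simplicial_complex] is required where needed.
   Links are closed under subsets but need not have every element of V as a
   vertex, hence are not [simplicial_complex] on all of V. *)
Definition simplicial_complex (V : finType) (K : set {set V}) : Prop :=
  [/\ K finset.set0,
      forall s t : {set V}, t \subset s -> K s -> K t
    & forall v : V, K (finset.set1 v)].

(* Simplices are tau_{i_1} * ... * tau_{i_k} with sigma = {i_1, ..., i_k} in K;
   the values of tau outside sigma are irrelevant. *)
Definition subst_complex (V : finType) (W : V -> finType)
    (K : set {set V}) (L : forall v, set {set W v}) :
    set {set {v : V & W v}} :=
  [set s | exists (sigma : {set V}) (tau : forall v, {set W v}),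
    [/\ K sigma, forall v, v \in sigma -> L v (tau v)
      & s = finset (fun x : {v : V & W v} =>
              (tag x \in sigma) && (tagged x \in tau (tag x)))]].

Definition join_complex (V W : finType) (K : set {set V}) (L : set {set W}) :
    set {set V + W} :=
  [set s | exists (sigma : {set V}) (tau : {set W}),
    [/\ K sigma, L tau
      & s = finset.setU [set inl v | v in sigma]%SET
                        [set inr w | w in tau]%SET]].

Definition link (V : finType) (K : set {set V}) (v : V) : set {set V} :=
  [set t | [/\ K t, v \notin t & K (finset.setU (finset.set1 v) t)]].

Definition bullet : set {set 'I_1} := setT.

(* [loc j] is the vertex of [cplx] named v_j: the original v_j before K_j is
   substituted, and v_{j,1} afterwards. *)
Record stage (m : nat) := Stage {
  vert : finType;
  cplx : set {set vert};
  loc : 'I_m -> vert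
}.
Arguments cplx {m} s.

Section SubstituteAt.
Variables (W : finType) (w0 : W) (L : set {set W}).

(* true: the vertex being replaced; false: a vertex replaced by a bullet. *)
Definition fiber_vert (b : bool) : finType := if b then W else 'I_1.

Definition fiber_complex (b : bool) : set {set fiber_vert b} :=
  match b return set {set fiber_vert b} with
  | true => L
  | false => bullet
  end.
Arguments fiber_complex b : clear implicits.

Definition fiber_first (b : bool) : fiber_vert b :=
  match b return fiber_vert b with true => w0 | false => ord0 end.

Definition substitute_at (m : nat) (i : 'I_m) (S : stage m) : stage m :=
  @Stage m {v : vert S & fiber_vert (v == loc S i)}
    (subst_complex (cplx S) (fun v => fiber_complex (v == loc S i)))
    (fun j => existT (fun v => Finite.sort (fiber_vert (v == loc S i)))
                     (loc S j) (fiber_first (loc S j == loc S i))).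

End SubstituteAt.

(* [iter_subst K L hn k] is K^k, for k <= m: with indices starting at 0, K^{k+1}
   substitutes L k (on 'I_(n k)) into the vertex v_k of K^k. *)
Fixpoint iter_subst (m : nat) (n : 'I_m -> nat) (K : set {set 'I_m})
    (L : forall i, set {set 'I_(n i)}) (hn : forall i, (0 < n i)%N)
    (k : nat) : stage m :=
  if k is k'.+1 then
    let S := iter_subst K L hn k' in
    if insub k' is Some i then substitute_at (Ordinal (hn i)) (L i) i S else S
  else @Stage m 'I_m K id.

(* Barycentric coordinates; V is finite, so the product topology on V -> R
   restricts to the usual topology of the polyhedron. *)
Definition polyhedron (R : realType) (V : finType) (K : set {set V}) :
    set {ptws V -> R} :=
  [set x | [/\ forall v, 0 <= x v, \sum_(v : V) x v = 1
             & K (finset (fun v => x v != 0))]].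
Arguments polyhedron R {V} K.

Definition realization (R : realType) (V : finType) (K : set {set V}) :
    topologicalType := set_type (polyhedron R K).

Definition homotopic (R : realType) (X Y : topologicalType) (f g : X -> Y) :
    Prop :=
  exists H : R * X -> Y,
    [/\ {within `[0%R, 1%R] `*` [set: X], continuous H},
        forall x, H (0, x) = f x
      & forall x, H (1, x) = g x].

Definition homotopy_equivalent (R : realType) (X Y : topologicalType) : Prop :=
  exists (f : X -> Y) (g : Y -> X),
    [/\ continuous f, continuous g,
        homotopic R (g \o f) id & homotopic R (f \o g) id].

(* The summands of K v \/_i (link_{K^i}(v_i) * K_i): None indexes K, and
   Some i the i-th join. *)
Definition wedge_summand (R : realType) (m : nat) (n : 'I_m -> nat)
    (K : set {set 'I_m}) (L : forall i, set {set 'I_(n i)})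
    (hn : forall i, (0 < n i)%N) (o : option 'I_m) : topologicalType :=
  match o with
  | None => realization R K
  | Some i =>
      let S := iter_subst K L hn i in
      realization R (join_complex (link (cplx S) (loc S i)) (L i))
  end.

(* Main.v *)
Require Import Defs.
From mathcomp Require Import all_boot all_order all_algebra.
From mathcomp Require Import all_classical all_reals topology wedge_sigT.
From mathcomp Require Import normedtype.
From mathcomp Require Import ring lra.

(* The vertices of every K^k are coded by pairs (i, j), so that K^k becomes the
   full subcomplex of X = K<K_1,...,K_m> on the pairs with i < k or j first.
   Passing from K^i to K^{i+1} glues link(v_i) * K_i to K^i along the cone
   v_i * link(v_i); contracting that cone on both sides, on a collar, gives
   explicit piecewise linear maps exhibiting K^{i+1} as K^i v (link(v_i) * K_i)
   relative to K^i, the wedge being taken at v_i, a vertex of K.  All homotopy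
   equivalences are kept relative to K, so that they compose.  The base points
   are then moved: along a path of K on one side, along a path of the join on
   the other, which uses that polyhedra are well pointed and that the join is
   path connected because the link is not empty when m > 1.  Wedges are
   realized inside products, so that maps out of and into them are given by
   formulas; the quotient [wedge p] only appears at the end. *)

Set Implicit Arguments.
Unset Strict Implicit.
Unset Printing Implicit Defensive.

Import Order.TTheory GRing.Theory Num.Theory.
Import numFieldNormedType.Exports.

Local Open Scope classical_set_scope.
Local Open Scope ring_scope.

(** * Continuity on a set *)

(** The base points of the wedge are arbitrary points of the summands, whereas each join hangs at
    the vertex v_i. This mismatch is why well-pointedness is proved at every point of a polyhedron
    and why a join has to be compared with itself pointed elsewhere.

    For m = 1 the join is K_1 itself, which may be disconnected, so there need not be a path from
    v_1 to the given base point; but K is then a single point and nothing has to be moved.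

    All spaces are subsets of ambient spaces of real functions, and maps are total formulas whose
    continuity and values matter only on those subsets. Whenever one of two vectors equals q at each
    point considered, their sum minus q is the other vector. This device occurs in every
    construction below and replaces the gluing of maps defined on two summands. *)

Definition ctson (T U : topologicalType) (A : set T) (f : T -> U) :=
  forall x, A x -> f y @[y --> within A (nbhs x)] --> f x.

Section Ctson.
Variables (T U V : topologicalType).
Implicit Types (A : set T) (B : set U).

Lemma eq_ctson A (f g : T -> U) : {in A, f =1 g} -> ctson A f -> ctson A g.
Proof.
move=> fg cf x Ax W; rewrite -fg ?inE // => nW.
have h : nbhs x [set y | A y -> W (f y)] by exact: (cf x Ax _ nW).
suff : nbhs x [set y | A y -> W (g y)] by [].
by apply: filterS h => y /= h Ay; rewrite -fg ?inE //; exact: h.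
Qed.

Lemma ctson_comp A B (f : T -> U) (g : U -> V) :
  (forall x, A x -> B (f x)) -> ctson A f -> ctson B g ->
  ctson A (fun x => g (f x)).
Proof.
move=> fAB cf cg x Ax W nW.
have h1 : nbhs (f x) [set y | B y -> W (g y)] by exact: (cg _ (fAB _ Ax) W nW).
have h2 : nbhs x [set y | A y -> B (f y) -> W (g (f y))].
  by exact: (cf x Ax _ h1).
suff : nbhs x [set y | A y -> W (g (f y))] by [].
by apply: filterS h2 => y /= h Ay; apply: h => //; exact: fAB.
Qed.

Lemma continuous_ctson A (f : T -> U) : continuous f -> ctson A f.
Proof. by move=> cf x Ax; apply: cvg_within_filter; exact: cf. Qed.

Lemma ctson_pair A (f : T -> U) (g : T -> V) : ctson A f -> ctson A g ->
  ctson A (fun x => (f x, g x)).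
Proof. by move=> cf cg x Ax; apply: cvg_pair; [exact: cf|exact: cg]. Qed.

Lemma ctson_cst A (c : U) : ctson A (fun=> c).
Proof. by move=> x Ax; exact: cvg_cst. Qed.

Lemma ctson_id A : ctson A id.
Proof. by move=> x Ax; exact: cvg_within. Qed.

(** Off a closed set the condition on that set is vacuous in a whole neighbourhood, so each closed
    piece yields a condition near every point of [A]. *)
Lemma ctson_setU (A A1 A2 : set T) (f : T -> U) :
  closed A1 -> closed A2 -> A `<=` A1 `|` A2 ->
  ctson (A `&` A1) f -> ctson (A `&` A2) f -> ctson A f.
Proof.
move=> c1 c2 sA cf1 cf2 x Ax W nW.
have H (B : set T) : closed B -> ctson (A `&` B) f ->
    nbhs x [set y | A y -> B y -> W (f y)].
  move=> cB cfB; have [Bx|nBx] := pselect (B x).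
    have h : nbhs x [set y | (A `&` B) y -> W (f y)].
      by exact: (cfB x (conj Ax Bx) W nW).
    by apply: filterS h => y /= h Ay By; exact: h.
  have h : nbhs x (~` B).
    by apply: open_nbhs_nbhs; split => //; exact: closed_openC.
  by apply: filterS h => y /= h _ By.
suff : nbhs x [set y | A y -> W (f y)] by [].
apply: filterS2 (H _ c1 cf1) (H _ c2 cf2) => y /= h1 h2 Ay.
by case: (sA y Ay) => By; [exact: h1|exact: h2].
Qed.

End Ctson.

Lemma ctson_fst (T U : topologicalType) (A : set (T * U)) : ctson A fst.
Proof. by apply: continuous_ctson => x; exact: cvg_fst. Qed.

Lemma ctson_snd (T U : topologicalType) (A : set (T * U)) : ctson A snd.
Proof. by apply: continuous_ctson => x; exact: cvg_snd. Qed.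


Lemma cvg_prod_topology (I : Type) (X : I -> topologicalType)
    (F : set_system (prod_topology X)) (f : prod_topology X) : Filter F ->
  (forall i, g i @[g --> F] --> f i) -> F --> f.
Proof.
move=> FF h; apply/cvg_sup => i.
move=> U [/= _ [[/= W oW <-]] /= Wf] /filterS; apply.
by apply: (h i W); exact: open_nbhs_nbhs.
Qed.

Lemma ctson_prod (T : topologicalType) (I : Type) (X : I -> topologicalType)
    (A : set T) (f : T -> prod_topology X) :
  (forall i, ctson A (fun x => f x i)) -> ctson A f.
Proof. by move=> h x Ax; apply: cvg_prod_topology => i; exact: h. Qed.

Lemma ctson_proj (I : eqType) (X : I -> topologicalType)
    (A : set (prod_topology X)) i : ctson A (fun x => x i).
Proof. by apply: continuous_ctson; exact: proj_continuous. Qed.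

Lemma ctson_coord (T V : topologicalType) (I : eqType)
    (A : set T) (f : T -> {ptws I -> V}) i :
  ctson A f -> ctson A (fun x => f x i).
Proof.
move=> cf.
apply: (ctson_comp (B := setT) (g := fun y : {ptws I -> V} => y i)) cf _ => //.
exact: ctson_proj.
Qed.

Section RealCtson.
Variables (R : realType) (T : topologicalType).
Implicit Types (A : set T) (f g : T -> R).

Lemma ctsonD A f g : ctson A f -> ctson A g -> ctson A (fun x => f x + g x).
Proof. by move=> cf cg x Ax; apply: cvgD; [exact: cf|exact: cg]. Qed.

Lemma ctsonN A f : ctson A f -> ctson A (fun x => - f x).
Proof. by move=> cf x Ax; apply: cvgN; exact: cf. Qed.

Lemma ctsonM A f g : ctson A f -> ctson A g -> ctson A (fun x => f x * g x).
Proof. by move=> cf cg x Ax; apply: cvgM; [exact: cf|exact: cg]. Qed.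

Lemma ctsonV A f : (forall x, A x -> f x != 0) -> ctson A f ->
  ctson A (fun x => (f x)^-1).
Proof. by move=> f0 cf x Ax; apply: cvgV; [exact: f0|exact: cf]. Qed.

Lemma ctson_norm A f : ctson A f -> ctson A (fun x => `|f x|).
Proof. by move=> cf x Ax; apply: cvg_norm; exact: cf. Qed.

Lemma ctson_max A f g : ctson A f -> ctson A g ->
  ctson A (fun x => Num.max (f x) (g x)).
Proof.
move=> cf cg; apply: (@eq_ctson _ _ _
  (fun x => (f x + g x + `|f x - g x|) * 2^-1)).
  by move=> x _; rewrite maxr_absE.
apply: ctsonM; last exact: ctson_cst.
apply: ctsonD; first exact: ctsonD.
by apply: ctson_norm; apply: ctsonD => //; exact: ctsonN.
Qed.

Lemma ctson_min A f g : ctson A f -> ctson A g ->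
  ctson A (fun x => Num.min (f x) (g x)).
Proof.
move=> cf cg; apply: (@eq_ctson _ _ _
  (fun x => (f x + g x - `|f x - g x|) * 2^-1)).
  by move=> x _; rewrite minr_absE.
apply: ctsonM; last exact: ctson_cst.
apply: ctsonD; first exact: ctsonD.
by apply/ctsonN/ctson_norm; apply: ctsonD => //; exact: ctsonN.
Qed.

Lemma ctson_sum A (I : Type) (r : seq I) (P : pred I) (f : I -> T -> R) :
  (forall i, ctson A (f i)) -> ctson A (fun x => \sum_(i <- r | P i) f i x).
Proof.
move=> cf x Ax; apply: cvg_big => [|i _]; last exact: cf.
by move=> z; apply: cvgD; [exact: cvg_fst|exact: cvg_snd].
Qed.

Lemma ctson_bigprod A (I : Type) (r : seq I) (P : pred I) (f : I -> T -> R) :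
  (forall i, ctson A (f i)) -> ctson A (fun x => \prod_(i <- r | P i) f i x).
Proof.
move=> cf x Ax; apply: cvg_big => [|i _]; last exact: cf.
by move=> z; apply: cvgM; [exact: cvg_fst|exact: cvg_snd].
Qed.

End RealCtson.

(** * Relative homotopies and wedges inside products *)

Section Homotopies.
Variable R : realType.

Definition unitI : set R := [set t | 0 <= t <= 1].

(* [P] is held fixed during the homotopy; it is meant to be a subset of [A]. *)
Definition homot (T U : topologicalType) (A : set T) (B : set U) (P : set T)
    (f g : T -> U) := exists H : R * T -> U,
  [/\ ctson (unitI `*` A) H,
      forall t x, unitI t -> A x -> B (H (t, x)),
      forall x, A x -> H (0, x) = f x,
      forall x, A x -> H (1, x) = g x
    & forall t x, unitI t -> P x -> H (t, x) = f x].

Lemma unitI0 : unitI 0. Proof. by rewrite /unitI /= lexx ler01. Qed.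
Lemma unitI1 : unitI 1. Proof. by rewrite /unitI /= lexx ler01. Qed.
Hint Resolve unitI0 unitI1 : core.

Section Basic.
Variables (T U : topologicalType) (A : set T) (B : set U) (P : set T).
Implicit Types f g h : T -> U.

Lemma eq_homot f g : ctson A f -> (forall x, A x -> B (f x)) -> P `<=` A ->
  (forall x, A x -> f x = g x) -> homot A B P f g.
Proof.
move=> cf fB PA fg; exists (fun z => f z.2); split => //=.
- apply: (ctson_comp (B := A)) cf; last exact: ctson_snd.
  by move=> [t x] [].
- by move=> t x _; exact: fB.
Qed.

Lemma homot_sym f g : P `<=` A -> homot A B P f g -> homot A B P g f.
Proof.
move=> PA [H [cH HB H0 H1 HP]]; exists (fun z => H (1 - z.1, z.2)).
have I t : unitI t -> unitI (1 - t) by rewrite /unitI /= => /andP[? ?]; lra.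
split.
- apply: (ctson_comp (f := fun z : R * T => (1 - z.1, z.2)) _ _ cH).
    by move=> [t x] [/= /I].
  apply: ctson_pair; last exact: ctson_snd.
  apply: ctsonD; first exact: ctson_cst.
  by apply: ctsonN; exact: ctson_fst.
- by move=> t x /I It Ax /=; exact: HB.
- by move=> x Ax /=; rewrite subr0 H1.
- by move=> x Ax /=; rewrite subrr H0.
- move=> t x /I It Px /=; rewrite HP // -H1; last exact: PA.
  by rewrite HP.
Qed.

Lemma homot_trans f g h : P `<=` A ->
  homot A B P f g -> homot A B P g h -> homot A B P f h.
Proof.
move=> PA [H [cH HB H0 H1 HP]] [K [cK KB K0 K1 KP]].
exists (fun z => if z.1 <= 2^-1 then H (2 * z.1, z.2) else K (2 * z.1 - 1, z.2)).
have I t : unitI t -> t <= 2^-1 -> unitI (2 * t).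
  by rewrite /unitI /= => /andP[? ?] ?; lra.
have J t : unitI t -> 2^-1 <= t -> unitI (2 * t - 1).
  by rewrite /unitI /= => /andP[? ?] ?; lra.
have J' t : unitI t -> (t <= 2^-1) = false -> unitI (2 * t - 1).
  by move=> It ht; apply: J => //; lra.
split => /=.
- have cl (D : set R) : closed D -> closed [set z : R * T | D z.1].
    by move=> cD; apply: (@closed_comp _ _ fst) cD => z _; exact: cvg_fst.
  apply: (@ctson_setU _ _ _ [set z : R * T | z.1 <= 2^-1]
                            [set z : R * T | 2^-1 <= z.1]).
  + by apply: (cl [set t | t <= 2^-1]); exact: closed_le.
  + by apply: (cl [set t | 2^-1 <= t]); exact: closed_ge.
  + by move=> z _ /=; case: (leP z.1 2^-1) => ht; [left|right; exact: ltW].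
  + apply: (@eq_ctson (R * T)%type _ _ (fun z : R * T => H (2 * z.1, z.2))).
      by move=> z /[!inE] -[_ /= ->].
    apply: (ctson_comp (f := fun z : R * T => (2 * z.1, z.2)) _ _ cH).
      by move=> [t x] [[/= It Ax] /= ht]; split => //=; exact: I.
    apply: ctson_pair; last exact: ctson_snd.
    by apply: ctsonM; [exact: ctson_cst|exact: ctson_fst].
  + apply: (@eq_ctson (R * T)%type _ _ (fun z : R * T => K (2 * z.1 - 1, z.2))).
      move=> [t x] /[!inE] -[[/= It Ax] /= ht]; case: ifPn => // ht'.
      have -> : 2 * t = 1 by lra.
      by rewrite subrr K0 // H1.
    apply: (ctson_comp (f := fun z : R * T => (2 * z.1 - 1, z.2)) _ _ cK).
      by move=> [t x] [[/= It Ax] /= ht]; split => //=; exact: J.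
    apply: ctson_pair; last exact: ctson_snd.
    apply: ctsonD; last exact: ctson_cst.
    by apply: ctsonM; [exact: ctson_cst|exact: ctson_fst].
- move=> t x It Ax; case: ifP => ht; first by apply: HB => //; exact: I.
  by apply: KB => //; exact: J'.
- by move=> x Ax; rewrite invr_ge0 ler0n mulr0 H0.
- move=> x Ax; rewrite ifF; last by lra.
  by rewrite mulr1 (_ : 2 - 1 = 1) ?K1 //; lra.
- move=> t x It Px; case: ifP => ht; first by rewrite HP //; exact: I.
  by rewrite KP; [rewrite -H1 ?HP //; exact: PA|exact: J'|].
Qed.

End Basic.

Lemma homot_compl (T U V : topologicalType) (A : set T) (B : set U) (C : set V)
    (P : set T) (f g : T -> U) (h : U -> V) :
  ctson B h -> (forall y, B y -> C (h y)) -> 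
  homot A B P f g -> homot A C P (fun x => h (f x)) (fun x => h (g x)).
Proof.
move=> ch hC [H [cH HB H0 H1 HP]]; exists (fun z => h (H z)); split => //=.
- by apply: (ctson_comp (f := H)) ch => // -[t x] [It Ax]; exact: HB.
- by move=> t x It Ax; apply/hC/HB.
- by move=> x Ax; rewrite H0.
- by move=> x Ax; rewrite H1.
- by move=> t x It Px; rewrite HP.
Qed.

Lemma homot_compr (T U V : topologicalType) (A : set T) (B : set U) (C : set V)
    (P : set T) (Q : set U) (f g : U -> V) (h : T -> U) :
  ctson A h -> (forall x, A x -> B (h x)) -> (forall x, P x -> Q (h x)) ->
  homot B C Q f g -> homot A C P (fun x => f (h x)) (fun x => g (h x)).
Proof.
move=> ch hB hQ [H [cH HB H0 H1 HP]]; exists (fun z => H (z.1, h z.2)).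
split => //=.
- apply: (ctson_comp (f := fun z : R * T => (z.1, h z.2)) _ _ cH).
    by move=> [t x] [It Ax]; split => //; exact: hB.
  apply: ctson_pair; first exact: ctson_fst.
  apply: (ctson_comp (B := A)) ch; last exact: ctson_snd.
  by move=> [t x] [].
- by move=> t x It Ax; apply/HB => //; exact: hB.
- by move=> x Ax; rewrite H0 //; exact: hB.
- by move=> x Ax; rewrite H1 //; exact: hB.
- by move=> t x It Px; rewrite HP //; exact: hQ.
Qed.

Lemma homot_subP (T U : topologicalType) (A : set T) (B : set U)
    (P Q : set T) (f g : T -> U) : P `<=` Q ->
  homot A B Q f g -> homot A B P f g.
Proof.
by move=> PQ [H [cH HB H0 H1 HP]]; exists H; split => // t x It /PQ; exact: HP.
Qed.

(* Homotopy equivalence under the set [KK], which maps to [A] by [i] and to [B]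
   by [j]. *)
Definition heqv (K : Type) (KK : set K) (T U : topologicalType)
    (A : set T) (i : K -> T) (B : set U) (j : K -> U) :=
  exists (f : T -> U) (g : U -> T),
  [/\ [/\ ctson A f, ctson B g, forall x, A x -> B (f x)
        & forall y, B y -> A (g y)],
      [/\ forall k, KK k -> f (i k) = j k & forall k, KK k -> g (j k) = i k],
      homot A A (i @` KK) (fun x => g (f x)) id
    & homot B B (j @` KK) (fun y => f (g y)) id].

Lemma heqv_trans (K : Type) (KK : set K) (T U V : topologicalType)
    (A : set T) (i : K -> T) (B : set U) (j : K -> U) (C : set V) (l : K -> V) :
  (forall k, KK k -> A (i k)) -> (forall k, KK k -> C (l k)) ->
  heqv KK A i B j -> heqv KK B j C l -> heqv KK A i C l.
Proof.
move=> iA lC [f [g [[cf cg fB gA] [fi gj] gf fg]]].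
move=> [f' [g' [[cf' cg' fC gB] [fj gl] gf' fg']]].
exists (fun x => f' (f x)), (fun y => g (g' y)); split.
- split; [exact: (ctson_comp fB)|exact: (ctson_comp gB)| |].
  + by move=> x /fB /fC.
  + by move=> x /gB /gA.
- by split => k KKk; [rewrite fi ?fj|rewrite gl ?gj].
- apply: (homot_trans (g := fun x => g (f x))) => //.
  + by move=> _ [k /iA ? <-].
  + apply: (@homot_compl _ _ _ _ B _ _ (fun x => g' (f' (f x))) _ g) => //.
    apply: (@homot_compr _ _ _ _ B _ _ (j @` KK) (fun x => g' (f' x)) id f) => //.
    by move=> _ [k KKk <-]; exists k => //; rewrite fi.
- apply: (homot_trans (g := fun x => f' (g' x))) => //.
  + by move=> _ [k /lC ? <-].
  + apply: (@homot_compl _ _ _ _ B _ _ (fun x => f (g (g' x))) _ f') => //.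
    apply: (@homot_compr _ _ _ _ B _ _ (j @` KK) (fun x => f (g x)) id g') => //.
    by move=> _ [k KKk <-]; exists k => //; rewrite gl.
Qed.

(** Shrinks the subspace held fixed: the splitting of K^{i+1} is relative to all of K^i, its
    composites only to K. *)
Lemma heqv_base (K K' : Type) (KK : set K) (KK' : set K') (u : K' -> K)
    (T U : topologicalType)
    (A : set T) (i : K -> T) (B : set U) (j : K -> U) i' j' :
  (forall k, KK' k -> [/\ KK (u k), i (u k) = i' k & j (u k) = j' k]) ->
  heqv KK A i B j -> heqv KK' A i' B j'.
Proof.
move=> h [f [g [[cf cg fB gA] [fi gj] gf fg]]]; exists f, g; split => //.
- by split => k /h [? <- <-]; [exact: fi|exact: gj].
- by apply: homot_subP gf => _ [k /h [Kk <- _] <-]; exists (u k).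
- by apply: homot_subP fg => _ [k /h [Kk _ <-] <-]; exists (u k).
Qed.

Lemma heqv_homeo (K : Type) (KK : set K) (T U : topologicalType)
    (A : set T) (i : K -> T) (B : set U) (j : K -> U) (f : T -> U) (g : U -> T) :
  (forall k, KK k -> A (i k)) -> (forall k, KK k -> f (i k) = j k) ->
  ctson A f -> ctson B g ->
  (forall x, A x -> B (f x) /\ g (f x) = x) ->
  (forall y, B y -> A (g y) /\ f (g y) = y) ->
  heqv KK A i B j.
Proof.
move=> iA fi cf cg fB gA; exists f, g; split.
- by split => // [x /fB []|x /gA []].
- by split=> // k KKk; rewrite -fi // (fB _ (iA _ KKk)).2.
- apply: eq_homot.
  + by apply: (ctson_comp (B := B)) cg => // x /fB [].
  + by move=> x /fB [/gA []].
  + by move=> _ [k /iA ? <-].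
  + by move=> x /fB [].
- apply: eq_homot.
  + by apply: (ctson_comp (B := A)) cf => // x /gA [].
  + by move=> x /gA [/fB []].
  + by move=> _ [k KKk <-]; rewrite -fi //; case: (fB _ (iA _ KKk)).
  + by move=> x /gA [].
Qed.

(* The wedge of [A] at [a] and [B] at [b], inside the product. *)
Definition wedge2 (T U : Type) (A : set T) (a : T) (B : set U) (b : U) :
    set (T * U) :=
  [set z | A z.1 /\ z.2 = b \/ z.1 = a /\ B z.2].

(** The attaching point [i k0] belongs to the fixed subspace and [b] is fixed too, so maps and
    homotopies can act coordinatewise on the product without leaving the wedge. This is what the
    relative form of [heqv] is for. *)
Lemma heqv_wedge2 (K : Type) (KK : set K) (k0 : K) (T T' U U' : topologicalType)
    (A : set T) (i : K -> T) (A' : set T') (i' : K -> T')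
    (B : set U) (b : U) (B' : set U') (b' : U') :
  KK k0 -> (forall k, KK k -> A (i k)) -> (forall k, KK k -> A' (i' k)) ->
  B b -> B' b' ->
  heqv KK A i A' i' -> heqv [set: unit] B (fun=> b) B' (fun=> b') ->
  heqv KK (wedge2 A (i k0) B b) (fun k => (i k, b))
          (wedge2 A' (i' k0) B' b') (fun k => (i' k, b')).
Proof.
have D (T1 T2 : topologicalType) (A1 : set T1) a1 (A2 : set T2) a2 (z : T1 * T2) :
    A1 a1 -> A2 a2 -> wedge2 A1 a1 A2 a2 z -> A1 z.1 /\ A2 z.2.
  by case: z => x y ? ? [] [/= h1 h2]; subst.
have C (T1 T2 T3 T4 : topologicalType) (A1 : set T1) a1 (A2 : set T2) a2
    (f : T1 -> T3) (g : T2 -> T4) : A1 a1 -> A2 a2 -> ctson A1 f -> ctson A2 g ->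
    ctson (wedge2 A1 a1 A2 a2) (fun z => (f z.1, g z.2)).
  move=> h1 h2 cf cg; apply: ctson_pair.
    apply: (ctson_comp (B := A1)) cf; last exact: ctson_fst.
    by move=> z /(D _ _ A1 a1 A2 a2 z h1 h2) [].
  apply: (ctson_comp (B := A2)) cg; last exact: ctson_snd.
  by move=> z /(D _ _ A1 a1 A2 a2 z h1 h2) [].
have Hm (T1 T2 : topologicalType) (A1 : set T1) a1 (A2 : set T2) a2
    (f : T1 -> T1) (g : T2 -> T2) (P : set T1) :
    A1 a1 -> A2 a2 -> P a1 -> f a1 = a1 -> g a2 = a2 ->
    homot A1 A1 P f id -> homot A2 A2 [set a2] g id ->
    homot (wedge2 A1 a1 A2 a2) (wedge2 A1 a1 A2 a2)
      [set z | P z.1 /\ z.2 = a2] (fun z => (f z.1, g z.2)) id.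
  move=> h1 h2 Pa1 fa ga [H [cH HB H0 H1 HP]] [G [cG GB G0 G1 GP]].
  exists (fun z => (H (z.1, z.2.1), G (z.1, z.2.2))); split => /=.
  - apply: ctson_pair.
      apply: (ctson_comp (f := fun z : R * (T1 * T2) => (z.1, z.2.1)) _ _ cH).
        by move=> [t z] [/= It /(D _ _ A1 a1 A2 a2 z h1 h2) []].
      apply: ctson_pair; first exact: ctson_fst.
      apply: (ctson_comp (B := setT)) => //; first exact: ctson_snd.
      exact: ctson_fst.
    apply: (ctson_comp (f := fun z : R * (T1 * T2) => (z.1, z.2.2)) _ _ cG).
      by move=> [t z] [/= It /(D _ _ A1 a1 A2 a2 z h1 h2) []].
    apply: ctson_pair; first exact: ctson_fst.
    apply: (ctson_comp (B := setT)) => //; first exact: ctson_snd.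
    exact: ctson_snd.
  - move=> t [x y] It [] [/= xA yA]; subst.
      by left; split; [exact: HB|rewrite GP].
    by right; split; [rewrite HP|exact: GB].
  - move=> [x y] /(D _ _ A1 a1 A2 a2 (x, y) h1 h2) [] /= ? ?.
    by rewrite H0 ?G0.
  - move=> [x y] /(D _ _ A1 a1 A2 a2 (x, y) h1 h2) [] /= ? ?.
    by rewrite H1 ?G1.
  - by move=> t [x y] It [/= Px ->]; rewrite HP ?GP.
move=> KK0 iA iA' Bb Bb' [f [g [[cf cg fB gA] [fi gj] gf fg]]].
move=> [h [e [[ch ce hB eB] [hb eb] eh he]]].
have hbb := hb tt I; have ebb := eb tt I.
exists (fun z => (f z.1, h z.2)), (fun z => (g z.1, e z.2)); split.
- split.
  + by apply: C => //; exact: iA.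
  + by apply: C => //; exact: iA'.
  + move=> [x y] [] [/= ? ?]; subst; first by left; split; [exact: fB|].
    by right; split; [exact: fi|exact: hB].
  + move=> [x y] [] [/= ? ?]; subst; first by left; split; [exact: gA|].
    by right; split; [exact: gj|exact: eB].
- by split => k KKk; [rewrite fi //= hbb|rewrite gj //= ebb].
- apply: (@homot_subP _ _ _ _ _ [set z | (i @` KK) z.1 /\ z.2 = b]).
    by move=> _ [k KKk <-]; split => //; exists k.
  apply: (Hm _ _ A (i k0) B b (fun x => g (f x)) (fun y => e (h y))
    (i @` KK)) => //; first exact: iA.
  + by rewrite fi // gj.
  + by rewrite hbb ebb.
  + by apply: homot_subP eh => _ ->; exists tt.
- apply: (@homot_subP _ _ _ _ _ [set z | (i' @` KK) z.1 /\ z.2 = b']).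
    by move=> _ [k KKk <-]; split => //; exists k.
  apply: (Hm _ _ A' (i' k0) B' b' (fun x => f (g x)) (fun y => h (e y))
    (i' @` KK)) => //; first exact: iA'.
  + by rewrite gj // fi.
  + by rewrite ebb hbb.
  + by apply: homot_subP he => _ ->; exists tt.
Qed.

End Homotopies.

(** * Well-pointed sets and moving the attaching point of a wedge *)

Ltac ctson_tac :=
  repeat match goal with
  | |- ctson _ (fun _ => ?c) => exact: ctson_cst
  | |- ctson _ (fun x => x) => exact: ctson_id
  | |- ctson _ fst => exact: ctson_fst
  | |- ctson _ snd => exact: ctson_snd
  | |- ctson _ (fun x => fst x) => exact: ctson_fst
  | |- ctson _ (fun x => snd x) => exact: ctson_snd
  | |- ctson _ (fun x => @?f x + @?g x) => apply: (@ctsonD _ _ _ f g)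
  | |- ctson _ (fun x => @?f x * @?g x) => apply: (@ctsonM _ _ _ f g)
  | |- ctson _ (fun x => - @?f x) => apply: (@ctsonN _ _ _ f)
  | |- ctson _ (fun x => Num.max (@?f x) (@?g x)) =>
      apply: (@ctson_max _ _ _ f g)
  | |- ctson _ (fun x => Num.min (@?f x) (@?g x)) =>
      apply: (@ctson_min _ _ _ f g)
  | |- ctson _ (fun x => (@?f x, @?g x)) => apply: (@ctson_pair _ _ _ _ f g)
  end.

Section WellPointed.
Variable R : realType.
Local Notation unitI := (@unitI R).
Local Notation homot := (@homot R _ _).

Definition path_in (T : topologicalType) (A : set T) (x y : T) :=
  exists g : R -> T,
    [/\ ctson unitI g, forall t, unitI t -> A (g t), g 0 = x & g 1 = y].

(** A path is a homotopy on a one-point space, so symmetry and transitivity are inherited from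
    [homot]. *)
Lemma path_in_homot (T : topologicalType) (A : set T) x y :
  path_in A x y <-> homot [set 0 : R] A set0 (fun=> x) (fun=> y).
Proof.
split=> [[g [cg gA g0 g1]]|[H [cH HB H0 H1 _]]].
  exists (fun z => g z.1); split => //=.
  - apply: (ctson_comp (f := fst)) cg; last exact: ctson_fst.
    by move=> [t s] [].
  - by move=> t s It _; exact: gA.
exists (fun t => H (t, 0)); split => //.
- apply: (ctson_comp (f := fun t : R => (t, 0 : R)) _ _ cH); first by [].
  by apply: ctson_pair; [exact: ctson_id|exact: ctson_cst].
- by move=> t It; exact: HB.
- exact: H0.
- exact: H1.
Qed.

Lemma path_in_refl (T : topologicalType) (A : set T) x : A x -> path_in A x x.
Proof. by move=> Ax; exists (fun=> x); split => //; exact: ctson_cst. Qed.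

Lemma path_in_sym (T : topologicalType) (A : set T) x y :
  path_in A x y -> path_in A y x.
Proof. by move=> /path_in_homot h; apply/path_in_homot/homot_sym. Qed.

Lemma path_in_trans (T : topologicalType) (A : set T) x y z :
  path_in A x y -> path_in A y z -> path_in A x z.
Proof.
move=> /path_in_homot h /path_in_homot k; apply/path_in_homot.
exact: homot_trans k.
Qed.

Lemma path_in_image (T U : topologicalType) (A : set T) (B : set U)
    (f : T -> U) x y :
  ctson A f -> (forall x, A x -> B (f x)) ->
  path_in A x y -> path_in B (f x) (f y).
Proof.
move=> cf fB /path_in_homot h; apply/path_in_homot.
exact: (@homot_compl _ _ _ _ _ A B set0 (fun=> x) (fun=> y) f).
Qed.

(** A neighbourhood deformation structure at [b]: [D] ends by collapsing the collar [mu >= 1/2] to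
    [b]. It stands in for the homotopy extension property of the inclusion of [b]. *)
Definition well_pointed (T : topologicalType) (B : set T) (b : T) :=
  exists (mu : T -> R) (D : R * T -> T),
  [/\ [/\ ctson B mu, forall x, B x -> 0 <= mu x <= 1 & mu b = 1],
      ctson (unitI `*` B) D, forall t x, unitI t -> B x -> B (D (t, x)),
      forall x, B x -> D (0, x) = x
    & (forall t, unitI t -> D (t, b) = b) /\
      (forall x, B x -> 2^-1 <= mu x -> D (1, x) = b)].

Section MoveBasePoint.
Variables (I : finType) (U : topologicalType).
Local Notation T := {ptws I -> R}.
Variables (Y : set T) (B : set U) (b : U) (mu : U -> R) (D : R * U -> U).
Hypotheses (Bb : B b) (cmu : ctson B mu)
  (mu01 : forall x, B x -> 0 <= mu x <= 1) (mub : mu b = 1)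
  (cD : ctson (unitI `*` B) D)
  (DB : forall t x, unitI t -> B x -> B (D (t, x)))
  (D0 : forall x, B x -> D (0, x) = x)
  (Db : forall t, unitI t -> D (t, b) = b)
  (D1 : forall x, B x -> 2^-1 <= mu x -> D (1, x) = b).

Let m x := Num.max (mu x) 2^-1.
Let mb : m b = 1. Proof. by rewrite /m mub maxEle; case: ifP => //; lra. Qed.
Let mI x : B x -> unitI (2 - 2 * m x).
Proof.
by move=> /mu01; rewrite /unitI /m /= maxEle; case: ifP => ? /andP[? ?]; lra.
Qed.
Let mI' x : B x -> unitI (2 * m x - 1).
Proof.
by move=> /mu01; rewrite /unitI /m /= maxEle; case: ifP => ? /andP[? ?]; lra.
Qed.
Let cm : ctson B m. Proof. by apply: (@ctson_max _ _ _ mu) => //; exact: ctson_cst. Qed.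

(** Let [g] lead from [q] to [q']. On the first summand [mu b = 1] makes the path parameter 0 and
    the map is the identity. On the second, where [z.1 = q], the collar [mu >= 1/2] is laid along
    [g], from [q] at [b] to [q'] at its rim, and the points beyond it are sent by [D (1, _)] into
    the copy attached at [q']. *)
Definition move_map (q : T) (g : R -> T) (z : T * U) : T * U :=
  ((fun i => z.1 i - q i + g (2 - 2 * Num.max (mu z.2) 2^-1) i) : T, D (1, z.2)).

Let wedgeB (q : T) z : Y q -> wedge2 Y q B b z -> Y z.1 /\ B z.2.
Proof. by case: z => x y Yq [[/= ? ->]|[/= -> ?]]. Qed.

Let ctson_g (S : topologicalType) (A : set S) (g : R -> T) (f : S -> R) i :
  ctson unitI g -> ctson A f -> (forall x, A x -> unitI (f x)) ->
  ctson A (fun x => g (f x) i).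
Proof.
move=> cg cf fI; apply: (@ctson_coord _ R I A (fun x => g (f x))).
exact: (ctson_comp fI).
Qed.

Let ctson_z1 (A : set (T * U)) i : ctson A (fun z => z.1 i).
Proof.
exact/(@ctson_coord _ R I A fst)/ctson_fst.
Qed.

Let ctson_D (S : topologicalType) (A : set S) (t : S -> R) (f : S -> U) :
  ctson A t -> ctson A f -> (forall x, A x -> unitI (t x) /\ B (f x)) ->
  ctson A (fun x => D (t x, f x)).
Proof.
move=> ct cf h; apply: (ctson_comp (f := fun x => (t x, f x)) _ _ cD).
  by move=> x /h [].
exact: ctson_pair.
Qed.

Lemma move_map_cts q g : Y q -> ctson unitI g ->
  ctson (wedge2 Y q B b) (move_map q g).
Proof.
move=> Yq cg; apply: ctson_pair.
  apply: ctson_prod => i; apply: ctsonD.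
    by apply: ctsonD; [exact: ctson_z1|exact: ctson_cst].
  apply: ctson_g => //; last by move=> z /(wedgeB Yq) [_ /mI].
  apply: ctsonD; first exact: ctson_cst.
  apply/ctsonN/ctsonM; first exact: ctson_cst.
  apply: (ctson_comp (f := snd)) cm; last exact: ctson_snd.
  by move=> z /(wedgeB Yq) [].
apply: ctson_D; [exact: ctson_cst|exact: ctson_snd|].
by move=> z /(wedgeB Yq) [_ ?]; split => //; exact: unitI1.
Qed.

Lemma move_map_id q g y : g 0 = q -> move_map q g (y, b) = (y, b).
Proof.
move=> g0; rewrite /move_map /= Db; last exact: unitI1.
congr pair; apply/funext => i; rewrite -/(m b) mb mulr1 subrr g0.
by rewrite subrK.
Qed.

Lemma move_map_wedge q q' g z : (forall t, unitI t -> Y (g t)) ->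
  g 0 = q -> g 1 = q' ->
  wedge2 Y q B b z -> wedge2 Y q' B b (move_map q g z).
Proof.
case: z => y x gY g0 g1 [] [/= h1 h2]; subst.
  by rewrite move_map_id //; left.
rewrite /move_map /= -/(m x) (_ : (fun i => _) = g (2 - 2 * m x)); last first.
  by apply/funext => i; rewrite subrr add0r.
have [xs|xs] := leP 2^-1 (mu x).
  left; rewrite /= D1 //; split => //; exact/gY/mI.
right; split => /=; last by apply: DB => //; exact: unitI1.
by rewrite /m maxEle ltW // (_ : 2 - _ = 1) //; lra.
Qed.

(** On the second summand the composite runs along [g] and back, its first coordinate being
    [g (n x)]. Scaling [n] to 0 pulls this detour in; running [D] backwards then undoes the two
    applications of [D (1, _)]. *)
Lemma move_map_homot q q' g : ctson unitI g -> (forall t, unitI t -> Y (g t)) ->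
  g 0 = q -> g 1 = q' ->
  homot (wedge2 Y q B b) (wedge2 Y q B b) [set z | Y z.1 /\ z.2 = b]
    (fun z => move_map q' (fun t => g (1 - t)) (move_map q g z)) id.
Proof.
move=> cg gY g0 g1.
have Yq : Y q by rewrite -g0; apply/gY/unitI0.
have sW : [set z | Y z.1 /\ z.2 = b] `<=` wedge2 Y q B b by move=> z; left.
(* The way out contributes the first term, the way back the second. In the collar [D (1, x) = b]
   makes the second one 1, outside it the first one is 1; so the minimum is the parameter actually
   reached. *)
pose n x := Num.min (2 - 2 * m x) (2 * m (D (1, x)) - 1).
have DBx x : B x -> B (D (1, x)) by apply: DB; exact: unitI1.
have nI x : B x -> unitI (n x).
  move=> Bx; have := mI Bx; have := mI' (DBx _ Bx).
  by rewrite /n /unitI /= minEle; case: ifP.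
have nb : n b = 0.
  rewrite /n mb Db; last exact: unitI1.
  by rewrite mb minEle; case: ifP; lra.
have cn : ctson B n.
  apply: ctson_min; ctson_tac => //.
  by apply: (ctson_comp (f := fun x => D (1, x))) cm => //;
     apply: ctson_D => //; [exact: ctson_cst|exact: ctson_id|split => //; exact: unitI1].
have tnI t x : unitI t -> B x -> unitI ((1 - t) * n x).
  move=> /andP[? ?] /nI /andP[? ?]; rewrite /unitI /= mulr_ge0 //; last by lra.
  by rewrite mulr_ile1 //; lra.
apply: (homot_trans (g := fun z => (z.1, D (1, D (1, z.2))))) => //.
  exists (fun w => ((fun i => w.2.1 i - q i + g ((1 - w.1) * n w.2.2) i) : T,
                    D (1, D (1, w.2.2)))); split.
  - have hB (w : R * (T * U)) : (unitI `*` wedge2 Y q B b) w ->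
        unitI w.1 /\ B w.2.2 by move=> [? /(wedgeB Yq) []].
    have c22 : ctson (unitI `*` wedge2 Y q B b) (fun w : R * (T * U) => w.2.2).
      apply: (ctson_comp (f := snd) (g := snd) (B := setT)) => //; exact: ctson_snd.
    have c21 : ctson (unitI `*` wedge2 Y q B b) (fun w : R * (T * U) => w.2.1).
      apply: (ctson_comp (f := snd) (g := fst) (B := setT)) => //.
        exact: ctson_snd.
      exact: ctson_fst.
    apply: ctson_pair.
      apply: ctson_prod => i; apply: ctsonD.
        apply: ctsonD; last exact: ctson_cst.
        exact: (@ctson_coord _ R I _ (fun w : R * (T * U) => w.2.1)).
      apply: ctson_g => //; last by move=> w /hB [? ?]; exact: tnI.
      apply: ctsonM; first by ctson_tac.
      by apply: (ctson_comp (f := fun w : R * (T * U) => w.2.2)) cn => // w /hB [].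
    apply: ctson_D; first exact: ctson_cst.
      apply: ctson_D => //; first exact: ctson_cst.
      by move=> w /hB [_ ?]; split => //; exact: unitI1.
    by move=> w /hB [_ ?]; split; [exact: unitI1|exact: DBx].
  - move=> t [y x] It [] [/= h1 h2]; subst.
      left; split => /=; last by rewrite !Db //; exact: unitI1.
      rewrite nb mulr0 (_ : (fun i => _) = y) //.
      by apply/funext => i; rewrite subrK.
    rewrite (_ : (fun i => _) = g ((1 - t) * n x)); last first.
      by apply/funext => i; rewrite subrr add0r.
    have [xs|xs] := leP 2^-1 (mu (D (1, x))).
      by left; split => /=; [exact/gY/tnI|rewrite D1 //; exact: DBx].
    right; split => /=; last exact/DBx/DBx.
    rewrite (_ : n x = 0) ?mulr0 //.
    have /andP[? ?] := mI h2.
    by rewrite /n {2}/m maxEle (ltW xs) minEle; case: ifP; lra.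
  - move=> [y x] [] [/= h1 h2]; subst.
      rewrite !move_map_id //; last by rewrite subr0.
      rewrite nb mulr0 Db ?Db; try exact: unitI1.
      by congr pair; apply/funext => i; rewrite subrK.
    rewrite /move_map /= -/(m x) -/(m (D (1, x))); congr pair.
    apply/funext => i; rewrite !subrr !add0r subr0 mul1r.
    have [xs|xs] := leP 2^-1 (mu x).
      rewrite D1 // mb /n D1 // mb (_ : 2 * 1 - 1 = 1); last by lra.
      rewrite (_ : 1 - (2 - 2 * 1) = 1); last by lra.
      rewrite subrK minEle; case: ifP => //.
      by have /andP[? ?] := mI h2; lra.
    have -> : 2 - 2 * m x = 1 by rewrite /m maxEle (ltW xs); lra.
    rewrite /n (_ : 2 - 2 * m x = 1); last by rewrite /m maxEle (ltW xs); lra.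
    rewrite subrr add0r; congr (g _ i).
    by have /andP[? ?] := mI' (DBx _ h2); rewrite minEle; case: ifP; lra.
  - move=> [y x] h; rewrite /= subrr mul0r g0; congr pair.
    by apply/funext => i; rewrite subrK.
  - move=> t [y x] It [/= Yy ->].
    rewrite !move_map_id //; last by rewrite subr0.
    rewrite nb mulr0 !Db; try exact: unitI1.
    by congr pair; apply/funext => i; rewrite g0 subrK.
have I1 t : unitI t -> unitI (1 - t) by rewrite /unitI /= => /andP[? ?]; lra.
exists (fun w => (w.2.1, D (1 - w.1, D (1 - w.1, w.2.2)))); split => /=.
- have hB (w : R * (T * U)) : (unitI `*` wedge2 Y q B b) w ->
      unitI w.1 /\ B w.2.2 by move=> [? /(wedgeB Yq) []].
  apply: ctson_pair.
    apply: (ctson_comp (f := snd) (g := fst) (B := setT)) => //.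
      exact: ctson_snd.
    exact: ctson_fst.
  have c22 : ctson (unitI `*` wedge2 Y q B b) (fun w : R * (T * U) => w.2.2).
    by apply: (ctson_comp (f := snd) (g := snd) (B := setT)) => //; exact: ctson_snd.
  apply: ctson_D; first by ctson_tac.
    apply: ctson_D => //; first by ctson_tac.
    by move=> w /hB [/I1 ? ?].
  by move=> w /hB [/I1 ? ?]; split => //; exact: DB.
- move=> t [y x] /I1 It [] [/= h1 h2]; subst; first by left; rewrite !Db.
  by right; split => //=; do 2 apply: DB => //.
- by move=> [y x] _ /=; rewrite subr0.
- by move=> [y x] /(wedgeB Yq) [/= _ Bx]; rewrite subrr !D0.
- by move=> t [y x] /I1 It [/= Yy ->]; rewrite !Db //; exact: unitI1.
Qed.

End MoveBasePoint.

(** The inverse is the map of the reversed path; reversing twice restores [g], so [move_map_homot]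
    covers both composites. *)
Lemma heqv_move (K : Type) (KK : set K) (I : finType) (U : topologicalType)
    (Y : set {ptws I -> R}) q q' (B : set U) b (i : K -> {ptws I -> R}) :
  (forall k, KK k -> Y (i k)) -> path_in Y q q' -> B b -> well_pointed B b ->
  heqv R KK (wedge2 Y q B b) (fun k => (i k, b))
            (wedge2 Y q' B b) (fun k => (i k, b)).
Proof.
move=> iY [g [cg gY g0 g1]] Bb [mu [D [[cmu mu01 mub] cD DB D0 [Db D1]]]].
have I1 t : unitI t -> unitI (1 - t) by rewrite /unitI /= => /andP[? ?]; lra.
have cg' : ctson unitI (fun t => g (1 - t)).
  by apply: (ctson_comp I1) cg; ctson_tac.
have gY' t : unitI t -> Y (g (1 - t)) by move=> /I1; exact: gY.
have g0' : g (1 - 0) = q' by rewrite subr0.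
have g1' : g (1 - 1) = q by rewrite subrr.
have Yq : Y q by rewrite -g0; exact/gY/unitI0.
have Yq' : Y q' by rewrite -g1; exact/gY/unitI1.
exists (move_map mu D q g), (move_map mu D q' (fun t => g (1 - t))); split.
- split; [exact: move_map_cts|exact: move_map_cts| |].
  + by move=> z; exact: move_map_wedge.
  + by move=> z; exact: move_map_wedge.
- by split => k KKk; exact: move_map_id.
- apply: (@homot_subP _ _ _ _ _ _ [set z | Y z.1 /\ z.2 = b]).
    by move=> _ [k KKk <-]; split => //; exact: iY.
  exact: (@move_map_homot I U Y B b mu D).
- apply: (@homot_subP _ _ _ _ _ _ [set z | Y z.1 /\ z.2 = b]).
    by move=> _ [k KKk <-]; split => //; exact: iY.
  have := @move_map_homot I U Y B b mu D Bb cmu mu01 mub cD DB D0 Db D1 q' q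
    (fun t => g (1 - t)) cg' gY' g0' g1'.
  have e : (fun t => g (1 - (1 - t))) = g by apply/funext => t; rewrite subKr.
  by rewrite e.
Qed.

End WellPointed.

(** * Changing the base point *)

Section PointedEquivalence.
Variables (R : realType) (I : finType).
Local Notation T := {ptws I -> R}.
Local Notation unitI := (@unitI R).
Local Notation homot := (@homot R _ _).
Local Notation well_pointed := (@well_pointed R _).
Local Notation path_in := (@path_in R _).
Variable B : set T.

(** Idle up to 1/2, then linear onto [0, 1]. Applied to time, it lets [D] collapse the collar before
    anything moves; applied to [mu], it vanishes off the collar. *)
Let pos (s : R) := Num.max 0 (2 * s - 1).
Let pos0 : pos 0 = 0. Proof. by rewrite /pos maxEle; case: ifP => //; lra. Qed.
Let pos1 : pos 1 = 1. Proof. by rewrite /pos maxEle; case: ifP => //; lra. Qed.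
Let posI s : unitI s -> unitI (pos s).
Proof. by rewrite /unitI /pos /= maxEle; case: ifP => ? /andP[? ?]; lra. Qed.
Let pos_le s : s <= 2^-1 -> pos s = 0.
Proof. by move=> ?; rewrite /pos maxEle; case: ifP => //; lra. Qed.
Let ctson_pos (S : topologicalType) (A : set S) (f : S -> R) :
  ctson A f -> ctson A (fun x => pos (f x)).
Proof. by move=> cf; rewrite /pos; ctson_tac. Qed.

(** Homotopy extension for the identity of [B] and the path [g] of [b]. In the first half of time
    [D] collapses the collar to [b]; in the second half the collar is pushed along [g], less far
    where [mu] is smaller. Off the collar the [g] term stays at [b] and cancels [- b i]. *)
Lemma transport b (g : R -> T) : well_pointed B b ->
  ctson unitI g -> (forall t, unitI t -> B (g t)) -> g 0 = b ->
  exists C : R * T -> T,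
  [/\ ctson (unitI `*` B) C, forall t x, unitI t -> B x -> B (C (t, x)),
      forall x, B x -> C (0, x) = x
    & forall t, unitI t -> C (t, b) = g (Num.max 0 (2 * t - 1))].
Proof.
move=> [mu [D [[cmu mu01 mub] cD DB D0 [Db D1]]]] cg gB g0.
have minI t : unitI t -> unitI (Num.min 1 (2 * t)).
  by rewrite /unitI /= minEle; case: ifP => ? /andP[? ?]; lra.
have pI t x : unitI t -> B x -> unitI (pos t * pos (mu x)).
  move=> /posI /andP[? ?] /mu01 /posI /andP[? ?].
  by rewrite /unitI /= mulr_ge0 //= mulr_ile1.
exists (fun z => (fun i => D (Num.min 1 (2 * z.1), z.2) i - b i
                 + g (pos z.1 * pos (mu z.2)) i) : T).
have Bb : B b by rewrite -g0; exact/gB/unitI0.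
split.
- apply: ctson_prod => i; apply: ctsonD.
    apply: ctsonD; last exact: ctson_cst.
    apply: (@ctson_coord _ R I _ (fun z : R * T => D (Num.min 1 (2 * z.1), z.2))).
    apply: (ctson_comp (f := fun z : R * T => (Num.min 1 (2 * z.1), z.2)) _ _ cD).
      by move=> [t x] [/= /minI].
    by ctson_tac.
  apply: (@ctson_coord _ R I _ (fun z : R * T => g (pos z.1 * pos (mu z.2)))).
  apply: (ctson_comp _ _ cg); first by move=> [t x] [? ?]; exact: pI.
  apply: ctsonM; apply: ctson_pos; first exact: ctson_fst.
  by apply: (ctson_comp (f := snd)) cmu; [move=> z [] | exact: ctson_snd].
- move=> t x It Bx /=.
  have [ht|ht] := leP t 2^-1.
    rewrite (pos_le ht) mul0r g0 (_ : (fun i => _) = D (Num.min 1 (2 * t), x)).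
      by apply: DB => //; exact: minI.
    by apply/funext => i; rewrite subrK.
  have -> : Num.min 1 (2 * t) = 1 by rewrite minEle; case: ifP => //; lra.
  have [hx|hx] := leP (mu x) 2^-1.
    rewrite (pos_le hx) mulr0 g0 (_ : (fun i => _) = D (1, x)).
      by apply: DB => //; exact: unitI1.
    by apply/funext => i; rewrite subrK.
  rewrite D1 ?ltW // (_ : (fun i => _) = g (pos t * pos (mu x))).
    exact/gB/pI.
  by apply/funext => i; rewrite subrr add0r.
- move=> x Bx /=; rewrite pos0 mul0r g0 mulr0 minEle ler10 D0 //.
  by apply/funext => i; rewrite subrK.
- move=> t It /=; rewrite mub pos1 mulr1 Db; last exact: minI.
  by apply/funext => i; rewrite subrr add0r.
Qed.

(* Extending a homotopy of a point: a homotopy [H] is homotopic, relative to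
   [b], to the composite of its initial map with a whisker along its trace. *)
Lemma homot_whisker b (mu : T -> R) (D : R * T -> T) (H : R * T -> T) :
  [/\ ctson B mu, forall x, B x -> 0 <= mu x <= 1 & mu b = 1] ->
  [/\ B b, ctson (unitI `*` B) D, forall t x, unitI t -> B x -> B (D (t, x)),
      forall x, B x -> D (0, x) = x & forall t, unitI t -> D (t, b) = b] ->
  ctson (unitI `*` B) H -> (forall t x, unitI t -> B x -> B (H (t, x))) ->
  homot B B [set b] (fun x => H (Num.max 0 (2 * mu x - 1), D (1, x)))
                    (fun x => H (1, x)).
Proof.
move=> [cmu mu01 mub] [Bb cD DB D0 Db] cH HB.
have I1 t : unitI t -> unitI (1 - t) by rewrite /unitI /= => /andP[? ?]; lra.
have sb : [set b] `<=` B by move=> _ ->.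
(* The segment from [s] to 1. It is constant for [s = 1], the value of [pos (mu x)] at the base
   point, so the base point does not move. *)
pose r (t s : R) := t + (1 - t) * s.
have rI t s : unitI t -> unitI s -> unitI (r t s).
  rewrite /unitI /r /= => /andP[? ?] /andP[? ?].
  have ? : (1 - t) * s <= (1 - t) * 1 by rewrite ler_wpM2l //; lra.
  have ? : 0 <= (1 - t) * s by rewrite mulr_ge0 //; lra.
  by lra.
have DB1 x : B x -> B (D (1, x)) by apply: DB; exact: unitI1.
apply: (homot_trans (g := fun x => H (1, D (1, x)))) => //.
  exists (fun z => H (r z.1 (pos (mu z.2)), D (1, z.2))); split => /=.
  - apply: (ctson_comp (f := fun z : R * T =>
      (r z.1 (pos (mu z.2)), D (1, z.2))) _ _ cH).
      move=> [t x] [/= It Bx]; split; last exact: DB1.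
      by apply: rI => //; exact/posI/mu01.
    have cmu' : ctson (unitI `*` B) (fun z => mu z.2).
      by apply: (ctson_comp (f := snd)) cmu; [move=> z [] | exact: ctson_snd].
    apply: ctson_pair.
      by rewrite /r; ctson_tac; exact: ctson_pos.
    apply: (ctson_comp (f := fun z : R * T => (1 : R, z.2)) _ _ cD).
      by move=> [t x] [/= ? ?]; split => //; exact: unitI1.
    by ctson_tac.
  - move=> t x It Bx; apply: HB; last exact: DB1.
    by apply: rI => //; exact/posI/mu01.
  - by move=> x Bx; rewrite /r add0r subr0 mul1r.
  - by move=> x Bx; rewrite /r subrr mul0r addr0.
  - move=> t _ It ->; rewrite mub pos1 /r.
    by rewrite -/(pos 1) pos1 mulr1 addrC subrK.
exists (fun z => H (1, D (1 - z.1, z.2))); split => /=.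
- apply: (ctson_comp (f := fun z : R * T => (1 : R, D (1 - z.1, z.2))) _ _ cH).
    by move=> [t x] [/= /I1 It Bx]; split; [exact: unitI1|exact: DB].
  apply: ctson_pair; first exact: ctson_cst.
  apply: (ctson_comp (f := fun z : R * T => (1 - z.1 : R, z.2)) _ _ cD).
    by move=> [t x] [/= /I1 It Bx].
  by ctson_tac.
- by move=> t x /I1 It Bx; apply: HB; [exact: unitI1|exact: DB].
- by move=> x Bx; rewrite subr0.
- by move=> x Bx; rewrite subrr D0.
- by move=> t _ /I1 It ->; rewrite !Db //; exact: unitI1.
Qed.

(** The trace of [p] under the free homotopy from [h] to the identity is a path from [p'] to [p],
    and transport of [p'] along it gives [c]. Now [C (t, h x)], from [h] to [c h], and the free
    homotopy, from [h] to the identity, have the same initial map and the same trace at [p]. By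
    [homot_whisker] their final maps are therefore both homotopic, relative to [p], to one and the
    same map. *)
Lemma pointed_left_inverse p p' (h : T -> T) : B p -> B p' ->
  well_pointed B p -> well_pointed B p' ->
  ctson B h -> (forall x, B x -> B (h x)) -> h p = p' -> homot B B set0 h id ->
  exists c : T -> T, [/\ ctson B c, forall x, B x -> B (c x), c p' = p,
    homot B B set0 c id & homot B B [set p] (fun x => c (h x)) id].
Proof.
move=> Bp Bp' [mu [D [[cmu mu01 mub] cD DB D0 [Db D1]]]] wp' ch hB hp.
move=> [E [cE EB E0 E1 _]].
have [|t It||C [cC CB C0 Cp]] := @transport p' (fun t => E (t, p)) wp'.
- apply: (ctson_comp (f := fun t : R => (t, p)) _ _ cE) => //.
  by apply: ctson_pair; [exact: ctson_id|exact: ctson_cst].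
- exact: EB.
- by rewrite E0.
exists (fun x => C (1, x)).
have cC1 : ctson B (fun x => C (1, x)).
  apply: (ctson_comp (f := fun x : T => (1 : R, x)) _ _ cC).
    by move=> x Bx; split => //; exact: unitI1.
  by apply: ctson_pair; [exact: ctson_cst|exact: ctson_id].
split => //.
- by move=> x Bx; apply: CB => //; exact: unitI1.
- by rewrite Cp ?pos1 ?E1 // -/(pos 1) ?pos1 ?E1 //; exact: unitI1.
- apply: homot_sym => //; exists C; split => //.
have sp : [set p] `<=` B by move=> _ ->.
pose H (z : R * T) := C (z.1, h z.2).
(* The delay [pos] is the one built into [transport], so that the traces of [H] and [K] at [p]
   coincide. *)
pose K (z : R * T) := E (pos z.1, z.2).
have cH : ctson (unitI `*` B) H.
  apply: (ctson_comp (f := fun z : R * T => (z.1, h z.2)) _ _ cC).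
    by move=> [t x] [/= ? ?]; split => //; exact: hB.
  apply: ctson_pair; first exact: ctson_fst.
  by apply: (ctson_comp (f := snd)) ch; [move=> z [] | exact: ctson_snd].
have HB t x : unitI t -> B x -> B (H (t, x)).
  by move=> It Bx; apply: CB => //; exact: hB.
have cK : ctson (unitI `*` B) K.
  apply: (ctson_comp (f := fun z : R * T => (pos z.1, z.2)) _ _ cE).
    by move=> [t x] [/= ? ?]; split => //; exact: posI.
  by apply: ctson_pair; [apply: ctson_pos; exact: ctson_fst|exact: ctson_snd].
have KB t x : unitI t -> B x -> B (K (t, x)).
  by move=> It Bx; apply: EB => //; exact: posI.
have W (G : R * T -> T) := @homot_whisker p mu D G (And3 cmu mu01 mub)
  (And5 Bp cD DB D0 Db).
have hH := W _ cH HB; have hK := W _ cK KB.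
have eHK : homot B B [set p] (fun x => H (pos (mu x), D (1, x)))
                             (fun x => K (pos (mu x), D (1, x))).
  have DB1 x : B x -> B (D (1, x)) by apply: DB; exact: unitI1.
  have pmI x : B x -> unitI (pos (mu x)) by move=> Bx; exact/posI/mu01.
  apply: eq_homot => //.
  - apply: (ctson_comp (f := fun x => (pos (mu x), D (1, x))) _ _ cH).
      by move=> x Bx; split; [exact: pmI|exact: DB1].
    apply: ctson_pair; first exact: ctson_pos.
    apply: (ctson_comp (f := fun x : T => (1 : R, x)) _ _ cD).
      by move=> x Bx; split => //; exact: unitI1.
    by apply: ctson_pair; [exact: ctson_cst|exact: ctson_id].
  - by move=> x Bx; apply: HB; [exact: pmI|exact: DB1].
  (* Off the collar both homotopies are still at time 0, hence equal to [h]; on it [D (1, x) = p]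
     and only the common trace is seen. *)
  move=> x Bx; rewrite /H /K /=; have [hx|hx] := leP (mu x) 2^-1.
    rewrite (pos_le hx) pos0 C0 ?E0 //; first exact: DB1.
    exact/hB/DB1.
  rewrite D1 ?ltW // hp Cp //; exact: pmI.
apply: (homot_trans _ (homot_sym _ hH)) => //.
apply: (homot_trans _ eHK) => //.
apply: (homot_trans _ hK) => //.
apply: eq_homot => //.
- apply: (ctson_comp (f := fun x : T => (1 : R, x)) _ _ cK).
    by move=> x Bx; split => //; exact: unitI1.
  by apply: ctson_pair; [exact: ctson_cst|exact: ctson_id].
- by move=> x Bx; apply: KB => //; exact: unitI1.
- by move=> x Bx; rewrite /K /= pos1 E1.
Qed.

(** Transport along the path gives [h], with pointed left inverse [c]. Since [c] is again freely
    homotopic to the identity, it has a pointed left inverse [d], and [h c ~ d c h c ~ d c ~ id]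
    relative to [p']. *)
Lemma heqv_base_point p p' : B p -> B p' ->
  well_pointed B p -> well_pointed B p' -> path_in B p p' ->
  heqv R [set: unit] B (fun=> p) B (fun=> p').
Proof.
move=> Bp Bp' wp wp' [g [cg gB g0 g1]].
have [C [cC CB C0 Cp]] := transport wp cg gB g0.
pose h x := C (1, x).
have ch : ctson B h.
  apply: (ctson_comp (f := fun x : T => (1 : R, x)) _ _ cC).
    by move=> x Bx; split => //; exact: unitI1.
  by apply: ctson_pair; [exact: ctson_cst|exact: ctson_id].
have hB x : B x -> B (h x) by apply: CB; exact: unitI1.
have hp : h p = p' by rewrite /h Cp -/(pos 1) ?pos1 ?g1 //; exact: unitI1.
have hid : homot B B set0 h id by apply: homot_sym => //; exists C; split.
have [c [cc cB cp' cid ch1]] := pointed_left_inverse Bp Bp' wp wp' ch hB hp hid.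
have [d [cd dB dp dc1 dc]] := pointed_left_inverse Bp' Bp wp' wp cc cB cp' cid.
have sp' : [set p'] `<=` B by move=> _ ->.
have E q : (fun=> q) @` [set: unit] = [set q] :> set T.
  by apply/seteqP; split=> [_ [_ _ <-]|_ ->] //; exists tt.
exists h, c; rewrite !E; split => //.
have hcB x : B x -> B (h (c x)) by move=> /cB /hB.
have chc : ctson B (fun x => h (c x)) by exact: (ctson_comp cB).
apply: (homot_trans (g := fun x => d (c (h (c x))))) => //.
  apply: homot_sym => //.
  apply: (@homot_compr _ _ _ _ B B B [set p'] [set p'] (fun x => d (c x)) id _ chc) => //.
  by move=> _ -> /=; rewrite cp' hp.
apply: (homot_trans (g := fun x => d (c x))) => //.
apply: (@homot_compl _ _ _ _ B B B [set p'] (fun x => c (h (c x))) c d) => //.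
apply: (@homot_compr _ _ _ _ B B B [set p'] [set p] (fun x => c (h x)) id c) => //.
by move=> _ -> /=.
Qed.

End PointedEquivalence.

(** * Splitting off the join *)

Section Polyhedra.
Variables (R : realType) (V : finType).
Local Notation T := {ptws V -> R}.
Local Notation unitI := (@unitI R).
Local Notation homot := (@homot R _ _).
Implicit Types (P Q : set {set V}) (x y : T).

Definition supp x : {set V} := finset (fun v => x v != 0).

Definition down_closed P := forall s t : {set V}, t \subset s -> P s -> P t.

Definition dirac (v : V) : T := fun w => (w == v)%:R.

Lemma dirac_ge0 v w : 0 <= dirac v w.
Proof. by rewrite /dirac; case: eqP. Qed.

Lemma sum_dirac v : \sum_w dirac v w = 1.
Proof.
rewrite (bigD1 v) //= /dirac eqxx big1 ?addr0 // => w /negPf -> //.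
Qed.

Lemma supp_dirac v : supp (dirac v) = finset.set1 v.
Proof.
by apply/setP => w; rewrite !inE /dirac; case: (w == v); rewrite ?eqxx ?oner_neq0.
Qed.

Lemma polyhedron_intro P x (s : {set V}) : down_closed P -> P s ->
  (forall v, 0 <= x v) -> \sum_v x v = 1 -> (forall v, x v != 0 -> v \in s) ->
  polyhedron R P x.
Proof.
move=> dP Ps x0 x1 xs; split => //; apply: dP Ps.
by apply/fintype.subsetP => v; rewrite inE; exact: xs.
Qed.

Lemma polyhedron_dirac P v : P (finset.set1 v) -> polyhedron R P (dirac v).
Proof.
move=> Pv; split; [exact: dirac_ge0|exact: sum_dirac|].
by rewrite -/(supp _) supp_dirac.
Qed.

(** Both values lie in one closed simplex, so the segment between them does, and it is constant
    where they agree. *)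
Lemma homot_line (S : topologicalType) P (A B : set S) (f g : S -> T) :
  down_closed P -> ctson A f -> ctson A g ->
  (forall z, A z -> polyhedron R P (f z)) ->
  (forall z, A z -> polyhedron R P (g z)) ->
  (forall z, A z -> exists2 s, P s & supp (f z) :|: supp (g z) \subset s) ->
  (forall z, B z -> f z = g z) ->
  homot A (polyhedron R P) B f g.
Proof.
move=> dP cf cg fP gP fgP fgB.
exists (fun z => (fun v => (1 - z.1) * f z.2 v + z.1 * g z.2 v) : T).
have line t z : unitI t -> A z ->
    polyhedron R P ((fun v => (1 - t) * f z v + t * g z v) : T).
  move=> /andP[t0 t1] Az; have [s Ps /fintype.subsetP sub] := fgP _ Az.
  have [f0 f1 _] := fP _ Az; have [g0 g1 _] := gP _ Az.
  apply: (polyhedron_intro dP Ps).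
  - by move=> v; rewrite addr_ge0 // mulr_ge0 //; lra.
  - by rewrite big_split /= -!mulr_sumr f1 g1; lra.
  - move=> v h; apply: sub; rewrite !inE; apply: contraNT h.
    by rewrite negb_or !negbK => /andP[/eqP -> /eqP ->]; rewrite !mulr0 addr0.
split => /=.
- apply: ctson_prod => v.
  have c2 (h : S -> T) : ctson A h -> ctson (unitI `*` A) (fun z => h z.2 v).
    move=> ch; apply: (@ctson_coord _ R V _ (fun z : R * S => h z.2)).
    by apply: (ctson_comp (f := snd)) ch; [move=> z [] | exact: ctson_snd].
  by apply: ctsonD; apply: ctsonM; ctson_tac; [exact: (c2 f)|exact: (c2 g)].
- by move=> t z; exact: line.
- by move=> z Az; apply/funext => v; rewrite subr0 mul1r mul0r addr0.
- by move=> z Az; apply/funext => v; rewrite subrr mul1r mul0r add0r.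
- by move=> t z It /fgB <-; apply/funext => v; rewrite -mulrDl subrK mul1r.
Qed.

Lemma path_in_line P x y : down_closed P ->
  polyhedron R P x -> polyhedron R P y -> P (supp x :|: supp y) ->
  path_in R (polyhedron R P) x y.
Proof.
move=> dP Px Py Pxy; apply/path_in_homot; apply: homot_line => //.
- exact: ctson_cst.
- exact: ctson_cst.
- by move=> _ _; exists (supp x :|: supp y).
Qed.

End Polyhedra.

(* A complex [X] in which a set [F] of vertices containing [v] replaces [v]:
   [X] is the union of its full subcomplex on the complement of [F \ v] and of
   the complex of those simplices whose part outside [F] can be joined to [v].
   The two pieces meet in a cone with apex [v]; contracting that cone inside
   each piece, on a collar on which the mass [u] of [F \ v] is small, splits [X]
   as a wedge. *)
Section Splitting.
Variables (R : realType) (V : finType).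
Local Notation T := {ptws V -> R}.
Local Notation unitI := (@unitI R).
Local Notation homot := (@homot R _ _).
Variables (X : set {set V}) (F : {set V}) (v : V).
Hypotheses (dX : down_closed X) (Xv : X (finset.set1 v))
  (hF : forall s, X s -> (exists2 w, w \in s & w \in F) -> X (v |: s :\: F)).

Definition outer_complex : set {set V} :=
  [set s | X s /\ forall w, w \in s -> w \in F -> w = v].
Definition inner_complex : set {set V} :=
  [set s | X s /\ X (v |: s :\: F)].
Local Notation Ac := outer_complex.
Local Notation Bc := inner_complex.
Local Notation d := (@dirac R V v).
Local Notation poly := (polyhedron R).

Lemma outer_down : down_closed Ac.
Proof.
move=> s t ts [Xs h]; split; first exact: dX Xs.
by move=> w /(fintype.subsetP ts); exact: h.
Qed.

Lemma inner_down : down_closed Bc.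
Proof.
move=> s t ts [Xs h]; split; first exact: dX Xs.
by apply: dX h; apply: finset.setUS; exact: finset.setSD.
Qed.

(* [s] retracts the region [u <= 1/2] radially onto [u = 0] and stretches the
   rest over the whole complex; [comb e x] moves [s x] towards [v].  As the mass
   grows, [e1] contracts to [v] in the outer piece while it is at most [1/4], and
   [e2] leaves [v] in the inner piece between [1/4] and [1/2]. *)
Let F' w := (w \in F) && (w != v).
Let u (x : T) := \sum_(w | F' w) x w.
Let s (x : T) : T := fun w =>
  if F' w then x w * (Num.max 0 (2 * u x - 1) / Num.max (u x) 2^-1)
  else x w / Num.max 2^-1 (1 - u x).
Let comb (e : R) (x : T) : T := fun w => (1 - e) * s x w + e * d w.
Let e1 (t : R) := Num.min 1 (4 * t).
Let e2 (t : R) := Num.min 1 (Num.max 0 (2 - 4 * t)).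

Let e1I t : 0 <= t -> unitI (e1 t).
Proof. by rewrite /e1 /unitI minEle /=; case: ifP; lra. Qed.
Let e2I t : unitI (e2 t).
Proof. by rewrite /e2 /unitI minEle maxEle /=; case: ifP; case: ifP; lra. Qed.
Let e1_1 t : 4^-1 <= t -> e1 t = 1.
Proof. by rewrite /e1 minEle; case: ifP; lra. Qed.
Let e2_1 t : t <= 4^-1 -> e2 t = 1.
Proof. by rewrite /e2 minEle maxEle; case: ifP; case: ifP; lra. Qed.
Let e1_0 : e1 0 = 0.
Proof. by rewrite /e1 mulr0 minEle; case: ifP => //; lra. Qed.
Let e2_0 t : 2^-1 <= t -> e2 t = 0.
Proof. by rewrite /e2 minEle maxEle; case: ifP; case: ifP; lra. Qed.

Let u01 P x : (poly P) x -> 0 <= u x <= 1.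
Proof.
move=> [x0 x1 _]; rewrite sumr_ge0 //= -x1 (bigID F') /= lerDl sumr_ge0 //.
Qed.

Let u0 P x : (poly P) x -> u x = 0 -> forall w, F' w -> x w = 0.
Proof. by move=> [x0 _ _] /psumr_eq0P h w Fw; exact: h. Qed.

Let s_small x w : u x <= 2^-1 -> F' w -> s x w = 0.
Proof.
move=> ux Fw; rewrite /s Fw [Num.max 0 _]maxEle.
case: ifP => [h|_]; last by rewrite mul0r mulr0.
by rewrite (_ : 2 * u x - 1 = 0) ?mul0r ?mulr0 //; lra.
Qed.

Let s_id P x : (poly P) x -> u x = 0 -> s x = x.
Proof.
move=> Px ux; apply/funext => w; have [Fw|Fw] := boolP (F' w).
  by rewrite s_small // ?ux ?(u0 Px ux) //; lra.
by rewrite /s (negPf Fw) ux subr0 maxEle ifT ?divr1 //; lra.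
Qed.

Let s_ge0 P x w : (poly P) x -> 0 <= s x w.
Proof.
move=> Px; have /andP[u0' u1'] := u01 Px; have [x0 _ _] := Px.
rewrite /s; case: ifP => _; rewrite mulr_ge0 // ?divr_ge0 ?invr_ge0 //.
- by rewrite le_max lexx.
- by rewrite le_max u0'.
- by rewrite le_max invr_ge0 ler0n.
Qed.

(** For [u x <= 1/2] the outside mass [1 - u x] is divided by itself and the rest is killed; for
    [u x >= 1/2] the two masses become [2 * u x - 1] and [2 * (1 - u x)]. *)
Let s_sum P x : (poly P) x -> \sum_w s x w = 1.
Proof.
move=> Px; have /andP[u0' u1'] := u01 Px; have [x0 x1 _] := Px.
rewrite (bigID F') /=.
under eq_bigr => w Fw do rewrite /s Fw.
under [X in _ + X]eq_bigr => w Fw do rewrite /s (negPf Fw).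
rewrite -!mulr_suml -/(u x).
have -> : \sum_(w | ~~ F' w) x w = 1 - u x.
  by have := x1; rewrite (bigID F') /= -/(u x); lra.
have [h|h] := leP (u x) 2^-1.
  rewrite (max_l (_ : 2 * u x - 1 <= 0)); last by lra.
  rewrite mul0r mulr0 add0r maxEle; case: ifP => h'; last by lra.
  by rewrite divff //; lra.
rewrite (max_r (_ : 0 <= 2 * u x - 1)); last by lra.
rewrite (max_l (_ : 1 - u x <= 2^-1)); last by lra.
by field; lra.
Qed.

Let s_supp x w : s x w != 0 -> x w != 0.
Proof. by rewrite /s; case: ifP => _; apply: contraNN => /eqP ->; rewrite mul0r. Qed.

Let comb0 x : comb 0 x = s x.
Proof. by apply/funext => w; rewrite /comb subr0 mul1r mul0r addr0. Qed.
Let comb1 x : comb 1 x = d.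
Proof. by apply/funext => w; rewrite /comb subrr mul1r mul0r add0r. Qed.
Let comb_ge0 P x e w : (poly P) x -> unitI e -> 0 <= comb e x w.
Proof.
move=> Px /andP[? ?]; rewrite /comb addr_ge0 // mulr_ge0 ?dirac_ge0 //.
  by lra.
exact: s_ge0 Px.
Qed.
Let comb_sum P x e : (poly P) x -> \sum_w comb e x w = 1.
Proof.
by move=> Px; rewrite big_split /= -!mulr_sumr (s_sum Px) sum_dirac; lra.
Qed.
Let comb_supp x e w : comb e x w != 0 -> w = v \/ x w != 0.
Proof.
rewrite /comb /dirac; case: (eqVneq w v) => [|_]; first by left.
by rewrite mulr0 addr0 mulf_eq0 negb_or => /andP[_ /s_supp]; right.
Qed.
(** In this range [s x] has no mass left on [F] except at [v], so moving it towards [v] stays in the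
    cone over [supp x :\: F], which for [x] in the inner piece is a simplex of both pieces. *)
Let comb_supp_small x e w : u x <= 2^-1 -> comb e x w != 0 ->
  w \in v |: supp x :\: F.
Proof.
move=> ux h; rewrite !inE; case: (eqVneq w v) => //= wv.
have := comb_supp h => -[/eqP|xw]; first by rewrite (negPf wv).
rewrite xw andbT; apply: contraNN h => wF.
rewrite /comb s_small //; last by rewrite /F' wF wv.
by rewrite /dirac (negPf wv) !mulr0 addr0.
Qed.

Let outer_d : (poly Ac) d.
Proof. by apply: polyhedron_dirac; split => // w; rewrite inE => /eqP. Qed.
Let inner_d : (poly Bc) d.
Proof.
apply: polyhedron_dirac; split => //; apply: dX Xv.
apply/fintype.subsetP => w; rewrite !inE.
by case: (eqVneq w v) => [//|_ /=]; rewrite andbF.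
Qed.

Let outer_sub x : (poly Ac) x -> (poly X) x.
Proof. by move=> [? ? []]. Qed.
Let inner_sub x : (poly Bc) x -> (poly X) x.
Proof. by move=> [? ? []]. Qed.
Let outer_u x : (poly Ac) x -> u x = 0.
Proof.
move=> [_ _ [_ h]]; rewrite /u big1 // => w /andP[wF /eqP wv].
by apply/eqP/negPn/negP => xw; apply: wv; apply: h; rewrite ?inE.
Qed.
Let u_outer x : (poly X) x -> u x = 0 -> (poly Ac) x.
Proof.
move=> Xx ux; have [x0 x1 Xs] := Xx; split => //; split => // w.
rewrite inE => xw wF; apply/eqP; apply: contraNT xw => wv.
by rewrite (u0 Xx ux) // /F' wF wv.
Qed.
Let pos_inner x : (poly X) x -> 0 < u x -> (poly Bc) x.
Proof.
move=> Xx ux; have [x0 x1 Xs] := Xx; split => //; split => //; apply: hF => //.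
have [w /andP[wF wv] xw] : exists2 w, F' w & x w != 0.
  apply: contrapT => h; move: ux; rewrite /u big1 ?ltxx // => w Fw.
  by apply/eqP/negPn/negP => xw; apply: h; exists w.
by exists w; rewrite ?inE.
Qed.
Let d_u : u d = 0. Proof. exact: outer_u. Qed.
Let s_d : s d = d. Proof. exact: s_id outer_d _. Qed.
Let comb_d e : comb e d = d.
Proof. by apply/funext => w; rewrite /comb s_d -mulrDl subrK mul1r. Qed.

Let inner_link x : (poly Bc) x -> Bc (v |: supp x :\: F).
Proof.
move=> [_ _ [_ Xs]]; split => //; apply: dX (Xs).
by apply/fintype.subsetP => w; rewrite !inE; case: (w == v); case: (w \in F).
Qed.
Let inner_link_outer x : (poly Bc) x -> Ac (v |: supp x :\: F).
Proof.
move=> [_ _ [_ Xs]]; split => // w; rewrite !inE => /orP[/eqP //|/andP[/negPf ->]] //.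
Qed.

(** Below 1/4 the point lies in the common cone; from 1/4 on it has reached [v]. A bound [u x <= t]
    instead of [t = u x] leaves room for the homotopy in [fg_id], which raises the parameter. *)
Let comb_outer x t : (poly Bc) x -> u x <= t -> (poly Ac) (comb (e1 t) x).
Proof.
move=> Bx ut; have /andP[u0' u1'] := u01 Bx.
have [t4|t4] := leP 4^-1 t; first by rewrite e1_1 // comb1.
apply: (polyhedron_intro outer_down (inner_link_outer Bx)).
- by move=> w; apply: comb_ge0 Bx _; apply: e1I; lra.
- exact: comb_sum Bx.
- by move=> w; apply: comb_supp_small; lra.
Qed.

Let comb_inner x t : (poly Bc) x -> u x <= t -> (poly Bc) (comb (e2 t) x).
Proof.
move=> Bx ut; have [t2|t2] := leP 2^-1 t; last first.
  apply: (polyhedron_intro inner_down (inner_link Bx)).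
  - by move=> w; exact: comb_ge0 Bx _.
  - exact: comb_sum Bx.
  - by move=> w; apply: comb_supp_small; lra.
have [_ _ Bs] := Bx; rewrite e2_0 // comb0; apply: (polyhedron_intro inner_down Bs).
- by move=> w; exact: s_ge0 Bx.
- exact: s_sum Bx.
- by move=> w /s_supp; rewrite inE.
Qed.

Let f x : T * T := (comb (e1 (u x)) x, comb (e2 (u x)) x).
(** The folding map: on the wedge one of the two coordinates is [d], and the formula returns the
    other. *)
Let g (z : T * T) : T := fun w => z.1 w + z.2 w - d w.
Local Notation W := (wedge2 (poly Ac) d (poly Bc) d).

Let g_outer x : g (x, d) = x.
Proof. by apply/funext => w; rewrite /g /= addrK. Qed.
Let g_inner x : g (d, x) = x.
Proof. by apply/funext => w; rewrite /g /= addrC addrA addNr add0r. Qed.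
Let f_outer x : (poly Ac) x -> f x = (x, d).
Proof.
move=> Ax; rewrite /f (outer_u Ax) e1_0 comb0 (s_id Ax) ?(outer_u Ax) //.
by rewrite e2_1 ?comb1 //; lra.
Qed.

Let fW x : (poly X) x -> W (f x).
Proof.
move=> Xx; have /andP[u0' _] := u01 Xx.
move: u0'; rewrite le_eqVlt => /predU1P[/esym|] ux.
  by rewrite f_outer; [left; split => //; exact: u_outer|exact: u_outer].
have Bx := pos_inner Xx ux.
have [t4|t4] := leP (u x) 4^-1.
  by left; split; [exact: comb_outer|rewrite /f /= e2_1 // comb1].
by right; split; [rewrite /f /= e1_1 ?comb1 // ltW|exact: comb_inner].
Qed.

Let gX z : W z -> (poly X) (g z).
Proof.
case: z => a b [] [/= h1 h2]; subst; first by rewrite g_outer; exact: outer_sub.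
by rewrite g_inner; exact: inner_sub.
Qed.

Let ctson_u (S : topologicalType) (A : set S) (h : S -> T) :
  ctson A h -> ctson A (fun z => u (h z)).
Proof. by move=> ch; apply: ctson_sum => w; exact: ctson_coord. Qed.

Let ctson_s (S : topologicalType) (A : set S) (h : S -> T) :
  ctson A h -> ctson A (fun z => s (h z)).
Proof.
move=> ch; apply: ctson_prod => w; rewrite /s; case: (F' w).
  apply: ctsonM; first exact: ctson_coord.
  apply: ctsonM; first by ctson_tac; exact: ctson_u.
  apply: ctsonV; last by ctson_tac; exact: ctson_u.
  by move=> z _; rewrite gt_eqF // lt_max invr_gt0 ltr0n orbT.
apply: ctsonM; first exact: ctson_coord.
apply: ctsonV; last by ctson_tac; exact: ctson_u.
by move=> z _; rewrite gt_eqF // lt_max invr_gt0 ltr0n.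
Qed.

Let ctson_comb (S : topologicalType) (A : set S) (e : S -> R) (h : S -> T) :
  ctson A e -> ctson A h -> ctson A (fun z => comb (e z) (h z)).
Proof.
move=> ce ch; apply: ctson_prod => w; rewrite /comb.
apply: ctsonD; apply: ctsonM => //; ctson_tac => //.
by apply: (@ctson_coord _ R V A (fun z => s (h z))); exact: ctson_s.
Qed.

Let ctson_f (A : set T) : ctson A f.
Proof.
have cu : ctson A u by apply: ctson_u; exact: ctson_id.
apply: ctson_pair; apply: ctson_comb; try exact: ctson_id.
  by rewrite /e1; ctson_tac.
by rewrite /e2; ctson_tac.
Qed.

Let ctson_g (S : topologicalType) (A : set S) (h k : S -> T) :
  ctson A h -> ctson A k -> ctson A (fun z => g (h z, k z)).
Proof.
move=> ch ck; apply: ctson_prod => w; rewrite /g /=.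
by apply: ctsonD; [apply: ctsonD; exact: ctson_coord|exact: ctson_cst].
Qed.

(** Two straight-line homotopies through [s]. The points [g (f x)] and [s x] are equal for
    [u x >= 1/2] and otherwise lie in the simplex [v |: supp x :\: F] or, when [u x = 0], both equal
    [x]; and [s x] never leaves the closed simplex of [x]. *)
Let gf_id : homot (poly X) (poly X) (poly Ac) (fun x => g (f x)) id.
Proof.
have sX x : (poly X) x -> (poly X) (s x).
  move=> Xx; have [_ _ Xs] := Xx; apply: (polyhedron_intro dX Xs).
  - by move=> w; exact: s_ge0 Xx.
  - exact: s_sum Xx.
  - by move=> w /s_supp; rewrite inE.
have ss x : supp (s x) \subset supp x.
  by apply/fintype.subsetP => w; rewrite !inE => /s_supp.
have cs : ctson (poly X) s by apply: ctson_s; exact: ctson_id.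
have cgf : ctson (poly X) (fun x => g (f x)).
  have cu : ctson (poly X) u by apply: ctson_u; exact: ctson_id.
  apply: ctson_g; apply: ctson_comb; try exact: ctson_id.
    by rewrite /e1; ctson_tac.
  by rewrite /e2; ctson_tac.
have gf_outer x : (poly Ac) x -> g (f x) = x by move=> Ax; rewrite f_outer.
apply: (homot_trans (g := s)) => //.
  apply: homot_line => //.
  - by move=> x Xx; exact/gX/fW.
  - move=> x Xx; have /andP[u0' _] := u01 Xx; have [_ _ Xs] := Xx.
    move: u0'; rewrite le_eqVlt => /predU1P[/esym|] ux.
      exists (supp x) => //; rewrite gf_outer; last exact: u_outer.
      by rewrite (s_id Xx) // finset.setUid.
    have Bx := pos_inner Xx ux.
    have [u2|u2] := leP 2^-1 (u x).
      exists (supp x) => //; rewrite /f e1_1; last by lra.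
      by rewrite e2_0 // comb0 comb1 g_inner finset.setUid.
    exists (v |: supp x :\: F); first by case: (inner_link Bx).
    apply/fintype.subsetP => w; rewrite inE => /orP[]; last first.
      by rewrite inE -comb0; apply: comb_supp_small; lra.
    rewrite inE /f; have [u4|u4] := leP (u x) 4^-1.
      by rewrite (e2_1 u4) comb1 g_outer; apply: comb_supp_small; lra.
    by rewrite e1_1 ?ltW // comb1 g_inner; apply: comb_supp_small; lra.
  - move=> x Ax; rewrite gf_outer // (s_id Ax) //; exact: outer_u.
apply: homot_line => //; first exact: ctson_id.
- move=> x [_ _ Xs]; exists (supp x) => //.
  by rewrite finset.subUset ss fintype.subxx.
- by move=> x Ax; rewrite (s_id Ax) //; exact: outer_u.
Qed.

Let fg_id : homot W W [set z | (poly Ac) z.1 /\ z.2 = d] (fun z => f (g z)) id.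
Proof.
have sW : [set z | (poly Ac) z.1 /\ z.2 = d] `<=` W by move=> z; left.
have W2 z : W z -> (poly Bc) z.2 by case: z => a b [] [/= _] // ->.
have W1 z : W z -> (poly Ac) z.1 by case: z => a b [] [/= ] // ->.
(* At time 0 this is [u], giving [f (g z)]; at time 1 it is at least 1/2, where [e1 = 1] and
   [e2 = 0], giving [(z.1, s z.2)]. In between one of [e1], [e2] is always 1, so one coordinate
   stays at the wedge point. *)
pose tau (w : R * (T * T)) := Num.max (u w.2.2) (w.1 / 2).
have utau w : u w.2.2 <= tau w by rewrite le_max lexx.
apply: (homot_trans (g := fun z => (z.1, s z.2))) => //.
  exists (fun w => (g (w.2.1, comb (e1 (tau w)) w.2.2), comb (e2 (tau w)) w.2.2)).
  split.
  - set D := unitI `*` W.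
    have c2 : ctson D (fun w : R * (T * T) => w.2.2).
      apply: (ctson_comp (f := snd) (g := snd) (B := setT)) => //; exact: ctson_snd.
    have c1 : ctson D (fun w : R * (T * T) => w.2.1).
      apply: (ctson_comp (f := snd) (g := fst) (B := setT)) => //.
        exact: ctson_snd.
      exact: ctson_fst.
    have ct : ctson D tau by rewrite /tau; ctson_tac; exact: ctson_u.
    apply: ctson_pair.
      by apply: ctson_g => //; apply: ctson_comb => //; rewrite /e1; ctson_tac.
    by apply: ctson_comb => //; rewrite /e2; ctson_tac.
  - move=> t [a b] It [] [/= h1 h2]; subst.
      by left; rewrite !comb_d /= g_outer.
    rewrite g_inner; set q := tau _; have uq := utau (t, (d, b)).
    have [q4|q4] := leP q 4^-1.
      by left; rewrite e2_1 //= comb1; split => //; exact: comb_outer.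
    right; rewrite e1_1 /= ?comb1 ?ltW //; split => //; exact: comb_inner.
  - move=> [a b] Wz; have /andP[ub0 _] := u01 (W2 _ Wz).
    have -> : tau (0, (a, b)) = u b.
      by rewrite /tau mul0r max_l.
    case: Wz => [] [/= h1 h2]; subst.
      by rewrite !comb_d !g_outer f_outer.
    by rewrite !g_inner.
  - move=> [a b] Wz; have t1 : 2^-1 <= tau (1, (a, b)).
      by rewrite /tau le_max mul1r lexx orbT.
    rewrite /= e1_1; last by lra.
    by rewrite e2_0 // comb1 comb0 g_outer.
  - by move=> t [a b] It [/= Aa ->]; rewrite !comb_d !g_outer f_outer.
have [H [cH HB H0 H1 HP]] : homot (poly Bc) (poly Bc) [set d] s id.
  apply: homot_line => //.
  - exact: inner_down.
  - by apply: ctson_s; exact: ctson_id.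
  - exact: ctson_id.
  - move=> x Bx; have [_ _ Bs] := Bx; apply: (polyhedron_intro inner_down Bs).
    + by move=> w; exact: s_ge0 Bx.
    + exact: s_sum Bx.
    + by move=> w /s_supp; rewrite inE.
  - move=> x [_ _ Bs]; exists (supp x) => //; rewrite finset.subUset fintype.subxx.
    by rewrite andbT; apply/fintype.subsetP => w; rewrite !inE => /s_supp.
  - by move=> _ ->.
exists (fun w => (w.2.1, H (w.1, w.2.2))); split => /=.
- apply: ctson_pair.
    apply: (ctson_comp (f := snd) (g := fst) (B := setT)) => //.
      exact: ctson_snd.
    exact: ctson_fst.
  apply: (ctson_comp (f := fun w : R * (T * T) => (w.1, w.2.2)) _ _ cH).
    by move=> [t z] [It /W2].
  apply: ctson_pair; first exact: ctson_fst.
  apply: (ctson_comp (f := snd) (g := snd) (B := setT)) => //; exact: ctson_snd.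
- move=> t [a b] It [] [/= h1 h2]; subst.
    by left; split => //=; rewrite HP ?s_d.
  by right; split => //=; exact: HB.
- by move=> [a b] /W2 Bb; rewrite H0.
- by move=> [a b] /W2 Bb; rewrite H1.
- by move=> t [a b] It [/= Aa ->]; rewrite HP.
Qed.

Lemma heqv_split :
  heqv R (poly Ac) (poly X) id (wedge2 (poly Ac) d (poly Bc) d) (fun x => (x, d)).
Proof.
exists f, g; split.
- split; [exact: ctson_f| |exact: fW|exact: gX].
  have := @ctson_g _ W fst snd (@ctson_fst _ _ _) (@ctson_snd _ _ _).
  by apply: eq_ctson => -[].
- by split => // x Ax; rewrite f_outer.
- by apply: homot_subP gf_id => _ [x Ax <-].
- by apply: homot_subP fg_id => _ [x Ax <-].
Qed.

End Splitting.

(** * Paths and base points in polyhedra *)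

Lemma set_val_continuous (T : topologicalType) (A : set T) :
  continuous (set_val : set_type A -> T).
Proof. exact: (@initial_continuous (set_type A) T set_val). Qed.

Definition to_realization (R : realType) (V : finType) (K : set {set V})
    (x : {ptws V -> R}) (Kx : polyhedron R K x) : realization R K :=
  exist _ x (mem_set Kx).

Lemma to_realizationK (R : realType) (V : finType) (K : set {set V})
    (x : {ptws V -> R}) (Kx : polyhedron R K x) :
  set_val (to_realization Kx) = x.
Proof. by rewrite set_valE. Qed.

Section PolyhedronPaths.
Variables (R : realType) (V : finType).
Local Notation T := {ptws V -> R}.
Local Notation unitI := (@unitI R).
Local Notation poly := (polyhedron R).

Lemma supp_neq0 P (x : T) : poly P x -> exists w, w \in supp x.
Proof.
move=> [x0 x1 _]; apply: contrapT => h; have := x1.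
rewrite big1 => [/eqP|w _].
  by rewrite eq_sym oner_eq0.
by apply/eqP/negPn/negP => xw; apply: h; exists w; rewrite inE.
Qed.

(** The function [mu] is nonzero only where the support contains that of [p], and there the segment
    from [x] to [p] stays in the closed simplex of [x]. The factor [e] slows this linear contraction
    to rest where [mu] vanishes and reaches full speed at [mu = 1/2]. *)
Lemma well_pointed_polyhedron P (p : T) : down_closed P -> poly P p ->
  well_pointed R (poly P) p.
Proof.
move=> dP Pp; have [p0 p1 Ps] := Pp.
pose mu (x : T) := \prod_v (if p v == 0 then 1 else Num.min 1 (x v / p v)).
have q01 (x : T) v : poly P x ->
    0 <= (if p v == 0 then 1 else Num.min 1 (x v / p v)) <= 1.
  move=> [x0 _ _]; case: ifP => _; first by rewrite ler01 lexx.
  by rewrite le_min ler01 divr_ge0 //= ge_min lexx.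
have mu01 x : poly P x -> 0 <= mu x <= 1.
  move=> Px; rewrite prodr_ge0 //=; last by move=> v _; have /andP[] := q01 x v Px.
  by apply: prodr_ile1 => v _; exact: q01.
have mu_supp x : poly P x -> mu x != 0 -> supp p \subset supp x.
  move=> Px h; apply/fintype.subsetP => v; rewrite !inE => pv.
  apply: contraNN h => /eqP xv; rewrite /mu (bigD1 v) //= (negPf pv) xv mul0r.
  by rewrite min_r ?mul0r.
pose e x := Num.min 1 (2 * mu x).
have eI x : poly P x -> unitI (e x).
  by move=> /mu01 /andP[? ?]; rewrite /unitI /e minEle /=; case: ifP; lra.
exists mu, (fun z => (fun v => z.2 v + z.1 * e z.2 * (p v - z.2 v)) : T).
have cmu (A : set T) : ctson A mu.
  apply: ctson_bigprod => v; case: (p v == 0); first exact: ctson_cst.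
  apply: ctson_min; first exact: ctson_cst.
  apply: ctsonM; last exact: ctson_cst.
  exact: (@ctson_coord _ R V A id v (@ctson_id _ A)).
have mup : mu p = 1.
  apply: big1 => v _; case: ifP => // /negbT pv; rewrite divff //.
  by rewrite min_l.
split => //.
- apply: ctson_prod => v.
  have c2 : ctson (unitI `*` poly P) (fun z : R * T => z.2 v).
    by apply: (@ctson_coord _ R V _ snd); exact: ctson_snd.
  apply: ctsonD => //; apply: ctsonM; last first.
    by apply: ctsonD; [exact: ctson_cst|exact: ctsonN].
  apply: ctsonM; first exact: ctson_fst.
  apply: ctson_min; first exact: ctson_cst.
  apply: ctsonM; first exact: ctson_cst.
  by apply: (ctson_comp (f := snd) (B := setT)); [|exact: ctson_snd|exact: cmu].
- move=> t x It Px; have [x0 x1 Xs] := Px; rewrite /=.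
  have [m0|m0] := eqVneq (mu x) 0.
    rewrite (_ : (fun v => _) = x) //; apply/funext => v.
    by rewrite /e m0 mulr0 min_r ?ler01 // mulr0 mul0r addr0.
  have /fintype.subsetP sub := mu_supp _ Px m0.
  set r := t * e x; have /andP[r0 r1] : 0 <= r <= 1.
    have /andP[? ?] := It; have /andP[? ?] := eI _ Px.
    by rewrite /r mulr_ge0 //= mulr_ile1.
  have E v : x v + r * (p v - x v) = (1 - r) * x v + r * p v by ring.
  apply: (polyhedron_intro dP Xs).
  + by move=> v; rewrite E addr_ge0 // mulr_ge0 //; lra.
  + under eq_bigr do rewrite E.
    by rewrite big_split /= -!mulr_sumr x1 p1; lra.
  + move=> v; apply: contraNT => xv.
    have pv : p v = 0.
      by apply/eqP/negPn/negP => pv; move: xv; rewrite sub // inE.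
    move: xv; rewrite inE negbK => /eqP xv.
    by rewrite pv xv subrr mulr0 addr0.
- by move=> x Px; apply/funext => v /=; rewrite mul0r mul0r addr0.
- split=> [t It|x Px mx]; apply/funext => v /=.
    by rewrite subrr mulr0 addr0.
  by rewrite mul1r /e min_l ?mul1r; [rewrite addrC subrK|lra].
Qed.

Lemma nbhs_supp (x : T) : (forall v, 0 <= x v) ->
  nbhs x [set y : T | supp x \subset supp y].
Proof.
move=> x0; have h v : nbhs x [set y : T | x v != 0 -> y v != 0].
  have [xv|xv] := eqVneq (x v) 0; first exact: filterS filterT.
  have : nbhs x ((fun y : T => y v) @^-1` [set r | r != 0]).
    apply: (@proj_continuous V (fun=> R) v x).
    by apply: open_nbhs_nbhs; split => //; exact: open_neq.
  by apply: filterS => y /= yv _.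
have : nbhs x [set y : T | forall v, x v != 0 -> y v != 0].
  exact: (@filter_forall T V (fun v => [set y : T | x v != 0 -> y v != 0])
            (nbhs x) (nbhs_filter x) h).
by apply: filterS => y /= hy; apply/fintype.subsetP => v; rewrite !inE; exact: hy.
Qed.

Lemma connected_clopen (X : topologicalType) (U : set X) x :
  connected [set: X] -> (forall y, U y -> nbhs y U) ->
  (forall y, ~ U y -> nbhs y (~` U)) -> U x -> U = setT.
Proof.
move=> cX oU oU' Ux; apply: cX; first by exists x.
  by exists U; rewrite ?setTI // openE => y; exact: oU.
exists U; rewrite ?setTI // -[U]setCK; apply: open_closedC.
by rewrite openE => y; exact: oU'.
Qed.

(** Near a point supports can only grow, so a segment joins it to all nearby points; path components
    are thus open, and so are their complements. *)
Lemma connected_path_in (K : set {set V}) (x y : T) : down_closed K ->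
  connected [set: realization R K] -> poly K x -> poly K y ->
  path_in R (poly K) x y.
Proof.
move=> dK cK Kx Ky.
pose U := [set z : realization R K | path_in R (poly K) (set_val z) y].
have near (z : realization R K) :
    nbhs z [set w : realization R K | path_in R (poly K) (set_val z) (set_val w)].
  have Kz : poly K (set_val z) by exact: set_valP.
  have [z0 _ _] := Kz.
  have h : nbhs z [set w : realization R K |
      supp (set_val z : T) \subset supp (set_val w : T)].
    apply: (@set_val_continuous _ (poly K) z
      [set y : T | supp (set_val z : T) \subset supp y]).
    exact: nbhs_supp.
  apply: filterS h => w /= zw.
  have Kw : poly K (set_val w) by exact: set_valP.
  apply: path_in_line => //; have [_ _ Ks] := Kw.
  by rewrite (finset.setUidPr zw).
suff UT : U = setT by have : U (to_realization Kx) by rewrite UT.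
apply: (@connected_clopen _ _ (to_realization Ky)) => //.
- move=> z Uz; apply: filterS (near z) => w /= /path_in_sym h.
  exact: path_in_trans h Uz.
- move=> z Uz; apply: filterS (near z) => w /= h Uw; apply: Uz.
  exact: path_in_trans h Uw.
- exact: path_in_refl.
Qed.

(** Without an edge at [v], the coordinate at [v] takes only the values 0 and 1, and the set where
    it is nonzero is clopen; it contains [v] but not [w]. *)
Lemma connected_neighbour (K : set {set V}) (v w : V) : down_closed K ->
  (forall a, K (finset.set1 a)) -> connected [set: realization R K] -> w != v ->
  exists2 a, a != v & K [set v; a]%SET.
Proof.
move=> dK vK cK wv; apply: contrapT => h.
pose U := [set z : realization R K | (set_val z : T) v != 0].
have val1 (z : realization R K) : (set_val z : T) v != 0 -> (set_val z : T) v = 1.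
  move=> zv; have [z0 z1 Ks] : poly K (set_val z) by exact: set_valP.
  rewrite -z1 (bigD1 v) //= big1 ?addr0 // => a av.
  apply/eqP/negPn/negP => za; apply: h; exists a => //; apply: dK Ks.
  by apply/fintype.subsetP => b; rewrite !inE => /orP[] /eqP ->.
have cv (z : realization R K) (A : set R) : open A -> A ((set_val z : T) v) ->
    nbhs z [set w : realization R K | A ((set_val w : T) v)].
  move=> oA Az; apply: (@set_val_continuous _ (poly K) z [set y : T | A (y v)]).
  apply: (@proj_continuous V (fun=> R) v (set_val z) A).
  exact: open_nbhs_nbhs.
have UT : U = setT.
  apply: (@connected_clopen _ _ (to_realization (polyhedron_dirac R (vK v)))) => //.
  - by move=> z Uz; apply: (cv z [set r | r != 0]) => //; exact: open_neq.
  - move=> z /negP /negPn /eqP zv.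
    apply: (filterS _ (cv z [set r | r < 1] _ _)).
    + by move=> a /= a1 /val1 a1'; move: a1; rewrite a1' ltxx.
    + exact: open_lt.
    + by rewrite /= zv ltr01.
  - by rewrite /U /= set_valE /= /dirac eqxx oner_neq0.
have : U (to_realization (polyhedron_dirac R (vK w))) by rewrite UT.
by rewrite /U /= set_valE /= /dirac [v == w]eq_sym (negPf wv) eqxx.
Qed.

(** Go from [x] to a vertex [w] of its support. If [w] lies outside [F], the inner complex has the
    edge from [w] to [v]; if not, pass through [a], a vertex joined to all of [F]. *)
Lemma inner_path_in (X : set {set V}) (F : {set V}) (v a : V) (x : T) :
  down_closed X -> v \in F -> a \notin F ->
  (forall w, w \in F -> X [set w; a]%SET) ->
  poly (inner_complex X F v) x ->
  path_in R (poly (inner_complex X F v)) x (dirac R v).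
Proof.
move=> dX vF aF Fa Bx; have [_ _ Bs] := Bx.
have dB := inner_down (F := F) (v := v) dX.
have line b c : inner_complex X F v [set b; c]%SET ->
    path_in R (poly (inner_complex X F v)) (dirac R b) (dirac R c).
  move=> Bbc; apply: path_in_line => //.
  - by apply/polyhedron_dirac/(dB _ _ _ Bbc); rewrite finset.sub1set !inE eqxx.
  - by apply/polyhedron_dirac/(dB _ _ _ Bbc); rewrite finset.sub1set !inE eqxx orbT.
  - by rewrite !supp_dirac.
have [w wx] := supp_neq0 Bx.
have Bw : inner_complex X F v (finset.set1 w).
  by apply: dB Bs; rewrite finset.sub1set.
apply: (path_in_trans (y := dirac R w)).
  apply: path_in_line => //; first exact: polyhedron_dirac.
  rewrite supp_dirac (finset.setUidPl _) // finset.sub1set //.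
have [wF|wF] := boolP (w \in F); last first.
  apply: line; have Xvw : X [set w; v]%SET.
    case: Bw => _; apply: dX; apply/fintype.subsetP => b.
    by rewrite !inE => /orP[] /eqP ->; rewrite ?wF ?eqxx ?orbT.
  split => //; apply: dX Xvw; apply/fintype.subsetP => b; rewrite !inE.
  by case: (b == v); rewrite ?orbT //= => /andP[_]; rewrite orbF.
apply: (path_in_trans (y := dirac R a)).
  apply: line; split; first exact: Fa.
  apply: dX (Fa _ vF); apply/fintype.subsetP => b; rewrite !inE.
  case: (b == v) => //= /andP[bF /orP[/eqP bw|//]].
  by rewrite bw wF in bF.
apply/line; split; first by rewrite finset.setUC; exact: Fa.
apply: dX (Fa _ vF); apply/fintype.subsetP => b; rewrite !inE.
by case: (b == v) => //= /andP[_]; rewrite orbF.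
Qed.

End PolyhedronPaths.

(** * Coding the vertices of the iterated substitution *)

(** The existential witnesses can be taken canonical: the tags that occur and the fibres over them.
    A fibre over another vertex is empty, which explains the condition on [finset.set0]. *)
Lemma subst_complexP (V : finType) (W : V -> finType) (K : set {set V})
    (L : forall v, set {set W v}) (s : {set {v : V & W v}}) :
  down_closed K -> (forall v, down_closed (L v)) -> (forall v, L v finset.set0) ->
  subst_complex K L s <->
  K [set tag x | x in s]%SET /\
  forall v, L v [set w | existT (fun v => W v : Type) v w \in s]%SET.
Proof.
move=> dK dL L0; split=> [[sigma [tau [Ks Lt ->]]]|[Ks Ls]].
  split; first apply: dK Ks.
    by apply/fintype.subsetP => _ /imsetP[x + ->]; rewrite inE => /andP[].
  move=> v; have [vs|vs] := boolP (v \in sigma).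
    apply: dL (Lt _ vs); apply/fintype.subsetP => w.
    by rewrite !inE /= vs.
  apply: dL (L0 v); apply/fintype.subsetP => w.
  by rewrite !inE /= (negPf vs).
exists [set tag x | x in s]%SET,
  (fun v => [set w | existT (fun v => W v : Type) v w \in s]%SET); split => //.
apply/setP => -[v w]; rewrite !inE /=; apply/idP/andP => [h|[_ //]].
by split => //; apply/imsetP; exists (existT _ v w).
Qed.

Section Fibers.
Variables (W : finType) (w0 : W) (L : set {set W}).

Definition fiber_dec (b : bool) : fiber_vert W b -> option W :=
  if b return fiber_vert W b -> option W then Some else fun=> None.

(** In use [b] is the test [v == loc S i], which does not compute; an equation from [true] to [b]
    can be eliminated to identify the fibre with [W]. *)
Definition fiber_cast (b : bool) (e : true = b) (w : W) : fiber_vert W b :=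
  match e in _ = b return fiber_vert W b with erefl => w end.

Lemma fiber_castP b (e : true = b) (f : fiber_vert W b) :
  exists w, f = fiber_cast e w.
Proof. by case: b / e f => f; exists f. Qed.

Lemma fiber_dec_cast b (e : true = b) w : fiber_dec (fiber_cast e w) = Some w.
Proof. by case: b / e. Qed.

Lemma fiber_dec_first b :
  fiber_dec (fiber_first w0 b) = if b then Some w0 else None.
Proof. by case: b. Qed.

Lemma fiber_bullet b (f g : fiber_vert W b) : b = false -> f = g.
Proof. by move=> e; move: f g; rewrite e /= => f g; rewrite (ord1 f) (ord1 g). Qed.

Lemma fiber_complex_cast b (e : true = b) (t : {set fiber_vert W b}) :
  fiber_complex L t <-> L [set w | fiber_cast e w \in t]%SET.
Proof.
case: b / e t => t /=; rewrite (_ : [set w | w \in t]%SET = t) //.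
by apply/setP => w; rewrite inE.
Qed.

Lemma fiber_complex_false b (t : {set fiber_vert W b}) :
  b = false -> fiber_complex L t.
Proof. by move=> e; move: t; rewrite e. Qed.

Lemma fiber_complex_down b : down_closed L -> down_closed (@fiber_complex W L b).
Proof. by case: b. Qed.

Lemma fiber_complex0 b : L finset.set0 -> @fiber_complex W L b finset.set0.
Proof. by case: b. Qed.

End Fibers.

Section Coding.
Variables (m : nat) (n : 'I_m -> nat) (K : set {set 'I_m})
  (L : forall i : 'I_m, set {set 'I_(n i)}) (hn : forall i : 'I_m, (0 < n i)%N).
Arguments L : clear implicits.
Hypotheses (hK : simplicial_complex K)
  (hL : forall i : 'I_m, simplicial_complex (L i)).

Local Notation V := {i : 'I_m & 'I_(n i)}.
Definition mkV (i : 'I_m) (j : 'I_(n i)) : V := existT (fun i => 'I_(n i) : Type) i j.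
Definition vroot (i : 'I_m) : V := mkV (Ordinal (hn i)).
Local Notation X := (subst_complex K L).
Definition fib (i : 'I_m) (s : {set V}) : {set 'I_(n i)} :=
  [set j | mkV j \in s]%SET.

Lemma mkV_inj i : injective (@mkV i).
Proof. by move=> a b /eqP; rewrite eq_Tagged => /eqP. Qed.

Let dK : down_closed K. Proof. by case: hK. Qed.
Let dL i : down_closed (L i). Proof. by case: (hL i). Qed.

Lemma substP (s : {set V}) :
  X s <-> K [set tag x | x in s]%SET /\ forall i, L i (fib i s).
Proof.
apply: subst_complexP; [exact: dK|exact: dL|by move=> i; case: (hL i)].
Qed.

Lemma fibS (i : 'I_m) (s t : {set V}) :
  s \subset t -> fib i s \subset fib i t.
Proof.
by move=> /fintype.subsetP st; apply/fintype.subsetP => j; rewrite !inE; exact: st.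
Qed.

Lemma subst_down : down_closed X.
Proof.
move=> s t ts /substP[Ks Ls]; apply/substP; split.
  by apply: dK Ks; exact: imsetS.
by move=> i; apply: dL (Ls i); exact: fibS.
Qed.

Lemma sub1_L i (s : {set 'I_(n i)}) :
  (forall j j', j \in s -> j' \in s -> j = j') -> L i s.
Proof.
move=> h; have [L0 Ld L1] := hL i.
have [->//|[j js]] := set_0Vmem s.
by apply: Ld (L1 j); apply/fintype.subsetP => j' j's; rewrite inE; apply/eqP/h.
Qed.

Lemma subst_transversal (s : {set V}) : K [set tag x | x in s]%SET ->
  (forall x y, x \in s -> y \in s -> tag x = tag y -> x = y) -> X s.
Proof.
move=> Ks h; apply/substP; split => // i; apply: sub1_L => j j'.
by rewrite !inE => js j's; apply: mkV_inj; exact: h.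
Qed.

(* The vertices of [K^k]. *)
Definition level (k : nat) (w : V) := (tag w < k)%N \/ w = vroot (tag w).

Definition level_complex (k : nat) : set {set V} :=
  [set s | X s /\ forall w, w \in s -> level k w].

Lemma level_down k : down_closed (level_complex k).
Proof.
move=> s t ts [Xs h]; split; first exact: subst_down Xs.
by move=> w /(fintype.subsetP ts) /h.
Qed.

Lemma level_complexT : level_complex m = X.
Proof.
by apply/seteqP; split=> [s []//|s Xs]; split => // w _; left.
Qed.

Definition block (i : 'I_m) : {set V} := [set w | tag w == i]%SET.

Lemma level_le k w : level k w -> level k.+1 w.
Proof. by case=> h; [left; exact: leqW|right]. Qed.

Lemma levelS (i : 'I_m) w : level i.+1 w -> tag w != i -> level i w.
Proof.
move=> [h|h] wi; last by right.
by left; rewrite ltn_neqAle -ltnS h andbT; apply: contra wi => /eqP/val_inj ->.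
Qed.

Lemma level_outer (i : 'I_m) :
  outer_complex (level_complex i.+1) (block i) (vroot i) = level_complex i.
Proof.
apply/seteqP; split=> s.
  move=> [[Xs h] hs]; split => // w ws.
  have [wi|wi] := eqVneq (tag w) i; last exact: levelS (h _ ws) wi.
  have wr : w = vroot i by apply: hs => //; rewrite inE wi.
  by right; rewrite wi.
move=> [Xs h]; split; first by split => // w /h /level_le.
move=> w ws; rewrite inE => /eqP wi; have [] := h _ ws; last by rewrite wi.
by rewrite wi ltnn.
Qed.

Lemma level_root k i : level_complex k (finset.set1 (vroot i)).
Proof.
split; last by move=> w; rewrite inE => /eqP ->; right.
apply: subst_transversal.
  by rewrite imset_set1; have [_ _] := hK; exact.
by move=> x y; rewrite !inE => /eqP -> /eqP ->.
Qed.

(** The hypothesis on [F] needed for the splitting. Replacing the part of a simplex in block i by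
    the root creates no new tag and makes the fibre over i a singleton. *)
Lemma level_star (i : 'I_m) s : level_complex i.+1 s ->
  (exists2 w, w \in s & w \in block i) ->
  level_complex i.+1 (vroot i |: s :\: block i).
Proof.
move=> [/substP[Ks Ls] h] [w ws]; rewrite inE => /eqP wi; split; last first.
  by move=> x; rewrite !inE => /orP[/eqP ->|/andP[_ /h //]]; right.
apply/substP; split.
  apply: dK Ks; apply/fintype.subsetP => _ /imsetP[x + ->].
  rewrite !inE => /orP[/eqP ->|/andP[_ xs]]; last exact: imset_f.
  by apply/imsetP; exists w.
move=> j; have [->|ji] := eqVneq j i.
  apply: sub1_L => a b; rewrite !inE /= eqxx /= !orbF.
  by move=> /eqP/mkV_inj -> /eqP/mkV_inj ->.
apply: dL (Ls j); apply/fintype.subsetP => a; rewrite !inE => /orP[/eqP e|/andP[]//].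
by have je : j = i := congr1 tag e; rewrite je eqxx in ji.
Qed.

Lemma level_edge (i j : 'I_m) w : j != i -> K [set i; j]%SET -> w \in block i ->
  level_complex i.+1 [set w; vroot j]%SET.
Proof.
rewrite inE => ji Kij /eqP wi; split; last first.
  by move=> x; rewrite !inE => /orP[] /eqP ->; [left; rewrite wi|right].
apply: subst_transversal.
  apply: dK Kij; apply/fintype.subsetP => _ /imsetP[x + ->].
  by rewrite !inE => /orP[] /eqP ->; rewrite ?wi /= eqxx ?orbT.
move=> x y; rewrite !inE => /orP[] /eqP -> /orP[] /eqP -> //=; rewrite wi => e.
  by rewrite e eqxx in ji.
by rewrite e eqxx in ji.
Qed.

(** Flattens the nested sigma types of the iterated substitution. The condition on [loc] keeps track
    of v_{j,1}, so that the next substitution happens at the right vertex. *)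
Definition coding (k : nat) (S : stage m) (code : vert S -> V) :=
  [/\ injective code, forall j, code (loc S j) = vroot j,
      forall a, level k (code a),
      forall w, level k w -> exists a, code a = w
    & forall s : {set vert S}, cplx S s <-> X [set code a | a in s]%SET].

Lemma coding0 : @coding 0 (@Stage m 'I_m K id) vroot.
Proof.
have rI : injective vroot by move=> i j /(congr1 tag).
split => //; first by right.
  by move=> w [//|->]; exists (tag w).
move=> s /=; have e : [set tag x | x in [set vroot a | a in s]]%SET = s.
  by rewrite -imset_comp (eq_imset (g := id)) ?imset_id.
split=> [Ks|/substP[]]; last by rewrite e.
apply: subst_transversal; first by rewrite e.
by move=> _ _ /imsetP[a _ ->] /imsetP[b _ ->] /= ->.
Qed.

Section Step.
Variables (S : stage m) (i : 'I_m) (code : vert S -> V).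
Hypothesis hcode : coding i code.
Local Notation S' := (substitute_at (Ordinal (hn i)) (L i) i S).
Local Notation W := 'I_(n i).
Local Notation FV := (fun v : vert S => Finite.sort (fiber_vert W (v == loc S i))).

Definition code_step (x : vert S') : V :=
  if fiber_dec (tagged x) is Some w then mkV w else code (tag x).

Let inn (w : W) : vert S' :=
  existT FV (loc S i) (fiber_cast (esym (eqxx (loc S i))) w).
Let out (a : vert S) : vert S' :=
  existT FV a (fiber_first (Ordinal (hn i) : W) (a == loc S i)).

Let vert_case (x : vert S') :
  (exists w, x = inn w) \/ (tag x != loc S i /\ x = out (tag x)).
Proof.
case: x => a f; have [e|ne] := eqVneq a (loc S i); last first.
  by right; split => //=; congr existT; apply: fiber_bullet; exact/negbTE.
left; subst a; have [w ->] := fiber_castP (esym (eqxx (loc S i))) f.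
by exists w.
Qed.

Let code_inn w : code_step (inn w) = mkV w.
Proof. by rewrite /code_step /= fiber_dec_cast. Qed.

(** Valid at [a = loc S i] too, because [fiber_first] picks there the vertex v_{i,1}, which is the
    code of [loc S i]. *)
Let code_out a : code_step (out a) = code a.
Proof.
rewrite /code_step /= fiber_dec_first; case: eqP => // ->.
by have [_ -> _ _ _] := hcode.
Qed.

Let tag_code x : tag (code_step x) = tag (code (tag x)).
Proof.
have [_ hloc _ _ _] := hcode.
have [[w ->]|[_ ->]] := vert_case x; last by rewrite code_out.
by rewrite code_inn /= hloc.
Qed.

Let code_block a : tag (code a) = i -> a = loc S i.
Proof.
have [inj hloc lev _ _] := hcode; move=> e; apply: inj; rewrite hloc.
by case: (lev a); rewrite e ?ltnn.
Qed.

Let code_step_inj : injective code_step.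
Proof.
have [inj hloc lev _ _] := hcode => x y.
have [[w ->]|[xl ->]] := vert_case x; have [[w' ->]|[yl ->]] := vert_case y.
- by rewrite !code_inn => /mkV_inj ->.
- rewrite code_inn code_out => e; move: yl.
  by rewrite (code_block (_ : tag (code (tag y)) = i)) -?e // eqxx.
- rewrite code_inn code_out => e; move: xl.
  by rewrite (code_block (_ : tag (code (tag x)) = i)) ?e // eqxx.
- by rewrite !code_out => /inj ->.
Qed.

Lemma coding_step : coding i.+1 code_step.
Proof.
have [inj hloc lev sur cpl] := hcode; split.
- exact: code_step_inj.
- by move=> j; rewrite -[RHS]hloc -code_out.
- move=> x; have [[w ->]|[_ ->]] := vert_case x.
    by rewrite code_inn; left => /=.
  by rewrite code_out; exact: level_le.
- move=> w lw; have [e|ne] := eqVneq (tag w) i.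
    case: w e {lw} => j w /= e; subst j.
    by exists (inn w); rewrite code_inn.
  have [a <-] := sur _ (levelS lw ne).
  by exists (out a); rewrite code_out.
move=> s.
have dS : down_closed (cplx S).
  move=> a b ba /cpl h; apply/cpl; apply: subst_down h; exact: imsetS.
have L0 : L i finset.set0 by case: (hL i).
have E1 : cplx S' s <-> cplx S [set tag x | x in s]%SET /\
    L i [set w | inn w \in s]%SET.
  have P := @subst_complexP (vert S) (fun v => fiber_vert W (v == loc S i))
    (cplx S) (fun v => @fiber_complex W (L i) (v == loc S i)) s dS
    (fun v => @fiber_complex_down _ _ _ (@dL i)) (fun v => @fiber_complex0 _ _ _ L0).
  have C := @fiber_complex_cast W (L i) _ (esym (eqxx (loc S i))).
  split=> [/P[h1 h2]|[h1 h2]]; last apply/P; split => //.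
    have := (C _).1 (h2 (loc S i)).
    by congr (L i _); apply/setP => w; rewrite !inE.
  move=> v; have [e|ne] : v = loc S i \/ v != loc S i.
  - by case: (eqVneq v (loc S i)); [left|right].
  - by subst v; apply/C; move: h2; congr (L i _); apply/setP => w; rewrite !inE.
  by apply: fiber_complex_false; exact/negbTE.
have Etag : [set tag x | x in [set code_step a | a in s]]%SET =
    [set tag x | x in [set code a | a in [set tag x | x in s]]]%SET.
  by rewrite -!imset_comp; apply: eq_imset => x; exact: tag_code.
have Ei : fib i [set code_step a | a in s]%SET = [set w | inn w \in s]%SET.
  by apply/setP => w; rewrite !inE -code_inn mem_imset.
have Ej j : j != i -> fib j [set code_step a | a in s]%SET =
    fib j [set code a | a in [set tag x | x in s]]%SET.
  move=> ji; apply/setP => w; rewrite !inE; apply/imsetP/imsetP.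
    move=> [x xs e]; exists (tag x); first exact: imset_f.
    have [[w' xw]|[_ xw]] := vert_case x; last by rewrite e xw code_out.
    by exfalso; move: ji; rewrite -[j]/(tag (mkV w)) e xw code_inn eqxx.
  move=> [_ /imsetP[x xs ->] e]; exists x => //.
  have [[w' xw]|[_ xw]] := vert_case x; last by rewrite e [in RHS]xw code_out.
  by exfalso; move: ji; rewrite -[j]/(tag (mkV w)) e xw /= hloc eqxx.
split=> [/E1[/cpl/substP[h1 h2] h3]|/substP[h1 h2]].
  apply/substP; rewrite Etag; split => // j.
  by have [->|ji] := eqVneq j i; [rewrite Ei|rewrite Ej].
apply/E1; split; last by rewrite -Ei.
apply/cpl/substP; rewrite -Etag; split => // j.
have [->|ji] := eqVneq j i; last by rewrite -Ej.
(* Before the substitution the root is the only vertex in block i, so this fibre has at most one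
   element. *)
apply: sub1_L => a b; rewrite !inE => /imsetP[x _ ea] /imsetP[y _ eb].
apply: mkV_inj; rewrite ea eb; congr code.
by rewrite (code_block (a := x)) -?ea // (code_block (a := y)) -?eb.
Qed.

(* The code of the vertices of [link * L_i], on which [loc S i] is a ghost. *)
Definition join_code (x : vert S + W) : V :=
  match x with inl a => code a | inr w => mkV w end.

(** The ghost and the first vertex of K_i have the same code, the root; without the ghost
    [join_code] is injective. *)
Definition join_dom : {set vert S + W} := [set~ inl (loc S i)]%SET.

Local Notation join := (join_complex (link (cplx S) (loc S i)) (L i)).
Local Notation inner :=
  (inner_complex (level_complex i.+1) (block i) (vroot i)).

Lemma join_code_inj : {in join_dom &, injective join_code}.
Proof.
have [inj _ _ _ _] := hcode.
move=> [a|w] [b|w']; rewrite !inE /= => h1 h2.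
- by move=> /inj ->.
- by move=> e; move: h1; rewrite (@code_block a) ?eqxx // e.
- by move=> e; move: h2; rewrite (@code_block b) ?eqxx // -e.
- by move=> /mkV_inj ->.
Qed.

Lemma joinP (s : {set vert S + W}) :
  join s <-> link (cplx S) (loc S i) [set a | inl a \in s]%SET /\
             L i [set w | inr w \in s]%SET.
Proof.
split=> [[t [r [lt Lr ->]]]|[h1 h2]]; last first.
  exists [set a | inl a \in s]%SET, [set w | inr w \in s]%SET; split => //.
  apply/setP => -[a|w]; rewrite finset.in_setU.
    rewrite mem_imset ?inE; last by move=> ? ? [].
    by rewrite orbC; case: imsetP => // -[].
  rewrite [X in _ || X]mem_imset ?inE; last by move=> ? ? [].
  by case: imsetP => // -[].
split.
  suff -> : [set a | inl a \in (inl @: t :|: inr @: r)%SET]%SET = t by [].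
  apply/setP => a; rewrite !inE mem_imset; last by move=> ? ? [].
  by rewrite orbC; case: imsetP => // -[].
suff -> : [set w | inr w \in (inl @: t :|: inr @: r)%SET]%SET = r by [].
apply/setP => a; rewrite !inE orbC mem_imset; last by move=> ? ? [].
by rewrite orbC; case: imsetP => // -[].
Qed.

Lemma join_sub s : join s -> s \subset join_dom.
Proof.
move=> /joinP[[_ h _] _]; apply/fintype.subsetP => x xs; rewrite !inE.
by apply: contra h => /eqP e; rewrite inE -e.
Qed.

Lemma join_code_sur s : inner s -> s \subset [set join_code x | x in join_dom]%SET.
Proof.
have [inj hloc lev sur cpl] := hcode.
move=> [[_ h] _]; apply/fintype.subsetP => w ws.
have [e|ne] := eqVneq (tag w) i.
  case: w e {ws} => j w /= e; subst j.
  by apply/imsetP; exists (inr w); rewrite ?inE.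
have [a ha] := sur _ (levelS (h _ ws) ne).
apply/imsetP; exists (inl a); rewrite ?inE //=.
by apply/eqP => -[al]; move: ne; rewrite -ha al hloc eqxx.
Qed.

(** The part of the coded set outside block i is the code of [t], so the second condition of the
    inner complex says that [t] is in the link. Given this, the first condition only adds that the
    fibre over i is a simplex of K_i: every tag already occurs in the root together with [t]. *)
Lemma join_code_complex (s : {set vert S + W}) : s \subset join_dom ->
  join s <-> inner [set join_code x | x in s]%SET.
Proof.
have [inj hloc lev sur cpl] := hcode => /fintype.subsetP sG.
set t := [set a | inl a \in s]%SET.
have tl : loc S i \notin t.
  by rewrite inE; apply/negP => /sG; rewrite !inE eqxx.
have tb a : a \in t -> tag (code a) != i.
  by move=> at'; apply: contraNN tl => /eqP/code_block <-.
have ED : [set join_code x | x in s]%SET :\: block i = [set code a | a in t]%SET.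
  apply/setP => w; rewrite finset.in_setD [w \in block i]inE; apply/andP/imsetP.
    move=> [wi /imsetP[[a|w'] xs e]]; last by rewrite e /= eqxx in wi.
    by exists a; rewrite // inE.
  move=> [a at' ->]; split; first exact: tb.
  by apply/imsetP; exists (inl a) => //; rewrite inE in at'.
have lvl (s' : {set V}) : (forall w, w \in s' -> level i.+1 w) ->
    level_complex i.+1 s' <-> X s' by move=> h; split => [[]|].
have El : cplx S (loc S i |: t) <-> X (vroot i |: [set code a | a in t])%SET.
  by rewrite cpl imsetU imset_set1 hloc.
have Elink : link (cplx S) (loc S i) t <-> X (vroot i |: [set code a | a in t])%SET.
  split=> [[_ _ /El] //|/El h]; split => //; apply/cpl.
  by apply: subst_down ((cpl _).1 h); apply: imsetS; exact: finset.subsetUr.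
have Einner : inner [set join_code x | x in s]%SET <->
    X [set join_code x | x in s]%SET /\ X (vroot i |: [set code a | a in t])%SET.
  rewrite /inner_complex /= ED !lvl //.
    move=> w; rewrite !inE => /orP[/eqP ->|/imsetP[a _ ->]]; first by right.
    exact/level_le/lev.
  move=> w /imsetP[[a|w'] _ ->] /=; first exact/level_le/lev.
  by left => /=.
have Efib : fib i [set join_code x | x in s]%SET = [set w | inr w \in s]%SET.
  apply/setP => w; rewrite !inE; apply/imsetP/idP => [[[a|w'] xs]|ws].
  - move=> e; have : a \in t by rewrite inE.
    by move=> /tb; rewrite -[code a]/(join_code (inl a)) -e eqxx.
  - by move=> /mkV_inj ->.
  - by exists (inr w).
split.
  move=> /joinP[/Elink h hw]; apply/Einner; split => //.
  have /substP[h1 h2] := h; apply/substP; split.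
    apply: dK h1; apply/fintype.subsetP => _ /imsetP[_ /imsetP[[a|w] xs ->] ->] /=.
      apply: imset_f; rewrite !inE; apply/orP; right; apply: imset_f.
      by rewrite inE.
    by apply/imsetP; exists (vroot i); rewrite ?inE ?eqxx.
  move=> j; have [->|ji] := eqVneq j i; first by rewrite Efib.
  apply: dL (h2 j); apply/fintype.subsetP => w; rewrite !inE.
  move=> /imsetP[[a|w'] xs e]; last first.
    by exfalso; move: ji; rewrite -[j]/(tag (mkV w)) e eqxx.
  by apply/orP; right; rewrite e; apply: imset_f; rewrite inE.
move=> /Einner[/substP[_ h1] /Elink h2]; apply/joinP; split => //.
by rewrite -Efib; exact: h1.
Qed.

End Step.

Lemma iter_coding k : (k <= m)%N ->
  exists code : vert (iter_subst K L hn k) -> V, coding k code.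
Proof.
elim: k => [|k IH] km; first by exists vroot; exact: coding0.
have [code hcode] := IH (ltnW km).
rewrite /=; case: insubP => [i _ ik|]; last by rewrite km.
move: code hcode; rewrite -ik => code hcode.
exists (code_step code).
exact: coding_step hcode.
Qed.

End Coding.

(** * Relabelling vertices *)

Section Relabelling.
Variables (R : realType) (A V : finType) (c : A -> V) (G : {set A}).
Variables (P : set {set A}) (Q : set {set V}).
Hypotheses (c_inj : {in G &, injective c})
  (PG : forall s, P s -> s \subset G)
  (QG : forall s, Q s -> s \subset [set c a | a in G]%SET)
  (PQ : forall s : {set A}, s \subset G -> P s <-> Q [set c a | a in s]%SET).

(** Summing over preimages preserves total mass whatever [c] is; vertices outside [G] are ghosts and
    carry none. *)
Definition push (x : {ptws A -> R}) : {ptws V -> R} :=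
  fun w => \sum_(a | c a == w) x a.
Definition pull (y : {ptws V -> R}) : {ptws A -> R} :=
  fun a => if a \in G then y (c a) else 0.

Let supp_G x a : polyhedron R P x -> a \notin G -> x a = 0.
Proof.
move=> [_ _ /PG /fintype.subsetP h] aG; apply/eqP/negPn/negP => xa.
by move: aG; rewrite h // inE.
Qed.

Let supp_cG y w :
  polyhedron R Q y -> w \notin [set c a | a in G]%SET -> y w = 0.
Proof.
move=> [_ _ /QG /fintype.subsetP h] wG; apply/eqP/negPn/negP => xa.
by move: wG; rewrite h // inE.
Qed.

Lemma pushK x : polyhedron R P x -> pull (push x) = x.
Proof.
move=> Px; apply/funext => a; rewrite /pull.
case: ifPn => aG; last by rewrite (supp_G Px aG).
rewrite /push (bigD1 a) //= big1 ?addr0 // => b /andP[/eqP cb ba].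
have [bG|/(supp_G Px) //] := boolP (b \in G).
by rewrite (c_inj bG aG cb) eqxx in ba.
Qed.

Lemma pullK y : polyhedron R Q y -> push (pull y) = y.
Proof.
move=> Qy; apply/funext => w; rewrite /push.
have [/imsetP[a aG ->]|wG] := boolP (w \in [set c a | a in G]%SET).
  rewrite (bigD1 a) //= /pull aG big1 ?addr0 // => b /andP[/eqP cb ba].
  by case: ifPn => // bG; rewrite (c_inj bG aG cb) eqxx in ba.
rewrite (supp_cG Qy wG) big1 // => a /eqP ca; rewrite /pull.
by case: ifPn => // aG; rewrite ca (supp_cG Qy wG).
Qed.

Lemma push_polyhedron x : polyhedron R P x -> polyhedron R Q (push x).
Proof.
move=> Px; have [x0 x1 Ps] := Px; split.
- by move=> w; apply: sumr_ge0.
- by rewrite -x1 (partition_big c predT).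
- move: (Ps) => /(PQ (PG Ps)).
  congr (Q _); apply/setP => w; rewrite [in RHS]inE; apply/imsetP/idP.
    move=> [a + ->]; rewrite inE => xa; rewrite /push psumr_neq0 //.
    by apply/hasP; exists a; rewrite ?mem_index_enum //= eqxx lt_def xa x0.
  rewrite /push psumr_neq0 // => /hasP[a _ /= /andP[/eqP ca xa]].
  by exists a => //; rewrite inE gt_eqF.
Qed.

Lemma pull_polyhedron y : polyhedron R Q y -> polyhedron R P (pull y).
Proof.
move=> Qy; have [y0 y1 Qs] := Qy.
have sG : finset (fun a => pull y a != 0) \subset G.
  by apply/fintype.subsetP => a; rewrite inE /pull; case: ifP => //; rewrite eqxx.
split.
- by move=> a; rewrite /pull; case: ifP.
- rewrite -big_mkcond -(big_imset (fun w => y w) c_inj) -y1 /=.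
  rewrite [RHS](bigID (fun w => w \in [set c a | a in G]%SET)) /=.
  by rewrite [X in _ = _ + X]big1 ?addr0 // => w /(supp_cG Qy).
- apply/(PQ sG); move: (Qs); congr (Q _); apply/setP => w.
  rewrite [in LHS]inE; apply/idP/imsetP => [yw|[a + ->]].
    have /imsetP[a aG wa] : w \in [set c a | a in G]%SET.
      by apply: contraNT yw => /(supp_cG Qy) ->.
    by exists a => //; rewrite inE /pull aG -wa.
  by rewrite inE /pull; case: ifP => //; rewrite eqxx.
Qed.

Lemma ctson_push (B : set {ptws A -> R}) : ctson B push.
Proof.
apply: ctson_prod => w; apply: ctson_sum => a.
exact: (@ctson_coord _ R A B id a (@ctson_id _ B)).
Qed.

Lemma ctson_pull (B : set {ptws V -> R}) : ctson B pull.
Proof.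
apply: ctson_prod => a; rewrite /pull; case: (a \in G); last exact: ctson_cst.
exact: (@ctson_coord _ R V B id (c a) (@ctson_id _ B)).
Qed.

End Relabelling.

(** * Assembling the wedge inside a product *)

Section WedgeInduction.
Variables (R : realType) (m : nat) (n : 'I_m -> nat).
Variables (K : set {set 'I_m}) (L : forall i : 'I_m, set {set 'I_(n i)})
  (hn : forall i : 'I_m, (0 < n i)%N).
Arguments L : clear implicits.
Hypotheses (hK : simplicial_complex K)
  (hL : forall i : 'I_m, simplicial_complex (L i)).
Local Notation V := {i : 'I_m & 'I_(n i)}.
Local Notation T := {ptws V -> R}.
Local Notation J := (option 'I_m).
Local Notation U := {ptws (J * V) -> R}.
Local Notation poly := (polyhedron R).
Local Notation lev := (level_complex K L hn).
Local Notation vroot := (vroot hn).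

Definition piece (o : J) : set {set V} :=
  if o is Some i then inner_complex (lev i.+1) (block n i) (vroot i) else lev 0.

Lemma piece_down o : down_closed (piece o).
Proof.
by case: o => [i|]; [apply: inner_down; exact: level_down|exact: level_down].
Qed.

Variable b : J -> T.
Hypothesis hb : forall o, poly (piece o) (b o).

(* The wedge of the first [k] joins and [K], inside the product over [J]. *)
Definition slice (y : U) (o : J) : T := fun w => y (o, w).
Definition wedge_set (k : nat) : set U :=
  [set y | [/\ forall o, poly (piece o) (slice y o),
    exists o, forall o', o' != o -> slice y o' = b o'
    & forall i : 'I_m, (k <= i)%N -> slice y (Some i) = b (Some i)]].

Definition set_slice (o : J) (y : U) (x : T) : U :=
  fun z => if z.1 == o then x z.2 else y z.

Definition wedge_pt : U := fun z => b z.1 z.2.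

Let sliceE (y y' : U) : (forall o, slice y o = slice y' o) -> y = y'.
Proof.
move=> h; apply/funext => -[o w].
by have := congr1 (fun f : T => f w) (h o).
Qed.

Let slice_set o y x o' :
  slice (set_slice o y x) o' = if o' == o then x else slice y o'.
Proof. by apply/funext => w; rewrite /slice /set_slice /=; case: ifP. Qed.

Let slice_pt o : slice wedge_pt o = b o. Proof. by []. Qed.

Let ctson_slice (S : topologicalType) (A : set S) (f : S -> U) o :
  ctson A f -> ctson A (fun z => slice (f z) o).
Proof.
by move=> cf; apply: ctson_prod => w; apply: (@ctson_coord _ R (J * V)%type A f).
Qed.

Let ctson_set_slice (S : topologicalType) (A : set S) (f : S -> U) (g : S -> T) o :
  ctson A f -> ctson A g -> ctson A (fun z => set_slice o (f z) (g z)).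
Proof.
move=> cf cg; apply: ctson_prod => -[o' w]; rewrite /set_slice /=.
case: (o' == o); first exact: (@ctson_coord _ R V A g).
exact: (@ctson_coord _ R (J * V)%type A f).
Qed.

Definition wedge_incl (x : T) : U := set_slice None wedge_pt x.

Let wedge_incl_in k x : poly (lev 0) x -> wedge_set k (wedge_incl x).
Proof.
move=> lx; split.
- by move=> o; rewrite slice_set; case: eqP => [->//|_]; exact: hb.
- by exists None => o /negPf oN; rewrite slice_set oN.
- by move=> i _; rewrite slice_set.
Qed.

Lemma wedge_induction0 :
  heqv R (poly (lev 0)) (poly (lev 0)) id (wedge_set 0) wedge_incl.
Proof.
apply: (@heqv_homeo _ _ _ _ _ _ _ _ _ wedge_incl (fun y => slice y None)) => //.
- by apply: ctson_set_slice; [exact: ctson_cst|exact: ctson_id].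
- by apply: ctson_slice; exact: ctson_id.
- by move=> x lx; split; [exact: wedge_incl_in|rewrite slice_set].
- move=> y [yQ _ yb]; split; first exact: (yQ None).
  by apply: sliceE => -[i|]; rewrite slice_set //= slice_pt yb.
Qed.

(** The splitting attaches the join at v_i in both summands. In the join, v_i is exchanged for
    [b (Some i)], the neighbour v_j providing the path; in [wedge_set i] the attaching point is
    moved to the image of [b None], along a path of K carried over by [wedge_incl]. *)
Lemma wedge_induction_step (i j : 'I_m) : connected [set: realization R K] ->
  j != i -> K [set i; j]%SET ->
  (forall x y, poly (lev 0) x -> poly (lev 0) y -> path_in R (poly (lev 0)) x y) ->
  heqv R (poly (lev 0)) (poly (lev i)) id (wedge_set i) wedge_incl ->
  heqv R (poly (lev 0)) (poly (lev i.+1)) id (wedge_set i.+1) wedge_incl.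
Proof.
move=> cK ji Kij pc IH.
have lev0 k x : poly (lev 0) x -> poly (lev k) x.
  move=> [x0 x1 [Xs h]]; split => //; split => // w /h [//|wr]; by right.
have dX : down_closed (lev i.+1) by exact: level_down.
have rB : vroot i \in block n i by rewrite inE.
have Xr : lev i.+1 (finset.set1 (vroot i)) by exact: level_root.
set d := dirac R (vroot i : V).
have dlev : poly (lev 0) d by apply: polyhedron_dirac; exact: level_root.
have := @heqv_split R _ (lev i.+1) (block n i) (vroot i) dX Xr
  (@level_star _ _ _ _ hn hK hL i).
rewrite level_outer -/d -/(piece (Some i)) => split.
have Bd : poly (piece (Some i)) d.
  apply: polyhedron_dirac; split => //; apply: dX Xr.
  apply/fintype.subsetP => w; rewrite !inE.
  by case: (eqVneq w (vroot i)) => [//|_ /=]; rewrite andbF.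
have dB := @piece_down (Some i).
have wpd := well_pointed_polyhedron dB Bd.
have wpb := well_pointed_polyhedron dB (hb (Some i)).
have pB : path_in R (poly (piece (Some i))) d (b (Some i)).
  apply: path_in_sym; apply: (@inner_path_in R _ _ _ _ (vroot j)) => //.
  - by rewrite inE.
  - by move=> w wi; exact: level_edge.
  - exact: (hb (Some i)).
have split0 : heqv R (poly (lev 0)) (poly (lev i.+1)) id
    (wedge2 (poly (lev i)) d (poly (piece (Some i))) d) (fun x => (x, d)).
  by apply: (heqv_base (u := id) _ split) => x lx; split => //; exact: lev0.
apply: (heqv_trans _ _ split0); [exact: lev0|exact: wedge_incl_in|].
have wed := @heqv_wedge2 R _ (poly (lev 0)) d _ _ _ _ (poly (lev i)) id
  (wedge_set i) wedge_incl (poly (piece (Some i))) d (poly (piece (Some i))) (b (Some i))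
  dlev (@lev0 i) (@wedge_incl_in i) Bd (hb _) IH
  (heqv_base_point Bd (hb _) wpd wpb pB).
apply: (heqv_trans _ _ wed).
- by move=> x lx; left; split => //=; exact: lev0.
- exact: wedge_incl_in.
have pW : path_in R (wedge_set i) (wedge_incl d) (wedge_incl (b None)).
  apply: (path_in_image (A := poly (lev 0)) (f := wedge_incl)).
  - by apply: ctson_set_slice; [exact: ctson_cst|exact: ctson_id].
  - exact: wedge_incl_in.
  - exact/pc/(hb None).
have mov := @heqv_move R _ (poly (lev 0)) _ _ (wedge_set i) _ _
  (poly (piece (Some i))) (b (Some i)) wedge_incl (@wedge_incl_in i) pW (hb _) wpb.
apply: (heqv_trans _ _ mov).
- by move=> x lx; left; split => //=; exact: wedge_incl_in.
- exact: wedge_incl_in.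
have kb : wedge_incl (b None) = wedge_pt.
  by apply: sliceE => -[o|]; rewrite slice_set.
rewrite kb.
(* Regrouping: in [wedge_set i] the slice at [Some i] is frozen at its base point, so the new join
   can be stored there. *)
apply: (@heqv_homeo _ _ _ _ _ _ _ _ _
  (fun z => set_slice (Some i) z.1 z.2)
  (fun y => (set_slice (Some i) y (b (Some i)), slice y (Some i)))).
- by move=> x lx; left; split => //=; exact: wedge_incl_in.
- move=> x lx /=; apply: sliceE => o; rewrite !slice_set.
  by case: (eqVneq o (Some i)) => [->|].
- by apply: ctson_set_slice; [exact: ctson_fst|exact: ctson_snd].
- apply: ctson_pair; last by apply: ctson_slice; exact: ctson_id.
  by apply: ctson_set_slice; [exact: ctson_id|exact: ctson_cst].
- move=> [y x] [[/= [yQ [o yo] yb] xb]|[/= yb xB]]; subst.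
    have yE : set_slice (Some i) y (b (Some i)) = y.
      by apply: sliceE => o'; rewrite slice_set; case: eqP => [->|//]; rewrite yb.
    rewrite !yE yb //; split => //; split => //; first by exists o.
    by move=> l il; apply: yb; exact: ltnW.
  split; first split.
  + by move=> o; rewrite slice_set; case: eqP => [->|_] //; exact: hb.
  + by exists (Some i) => o /negPf oi; rewrite slice_set oi.
  + move=> l il; rewrite slice_set; case: eqP => // -[li].
    by rewrite li ltnn in il.
  + rewrite slice_set eqxx; congr pair; apply: sliceE => o.
    by rewrite !slice_set; case: eqP => // ->.
- move=> y [yQ [o yo] yb]; split; last first.
    by apply: sliceE => o'; rewrite !slice_set /=; case: eqP => // ->.
  have [oi|oi] := eqVneq o (Some i).
    right; split => /=; last exact: (yQ (Some i)).
    apply: sliceE => o'; rewrite slice_set slice_pt.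
    by case: eqP => [->//|/eqP o'i]; apply: yo; rewrite oi.
  left; rewrite /= (yo (Some i)) 1?eq_sym //; split => //; split.
  + by move=> o'; rewrite slice_set; case: eqP => [->|_]; [exact: hb|exact: yQ].
  + by exists o => o' o'o; rewrite slice_set; case: eqP => [->//|_]; exact: yo.
  + move=> l; rewrite leq_eqVlt => /predU1P[/val_inj ->|il].
      by rewrite slice_set eqxx.
    rewrite slice_set; case: eqP => [[li]|_]; last exact: yb.
    by rewrite li.
Qed.

Lemma wedge_induction : (1 < m)%N -> connected [set: realization R K] ->
  (forall x y, poly (lev 0) x -> poly (lev 0) y -> path_in R (poly (lev 0)) x y) ->
  heqv R (poly (lev 0)) (poly (subst_complex K L)) id (wedge_set m) wedge_incl.
Proof.
move=> m1 cK pc; rewrite -(level_complexT K L hn).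
have : forall k, (k <= m)%N ->
    heqv R (poly (lev 0)) (poly (lev k)) id (wedge_set k) wedge_incl; last exact.
elim=> [|k IH] km; first exact: wedge_induction0.
pose i := Ordinal km.
(* A second vertex exists as m > 1, and connectedness then yields an edge at v_i, that is, a vertex
   of its link. *)
have [i' i'i] : exists i' : 'I_m, i' != i.
  have m0 : (0 < m)%N by exact: ltnW.
  have [e|ne] := eqVneq (Ordinal m0) i; last by exists (Ordinal m0).
  by exists (Ordinal m1); rewrite -e.
have [_ K1 K2] := hK.
have [j ji Kij] := connected_neighbour K1 K2 cK i'i.
exact: (@wedge_induction_step i j cK ji Kij pc (IH (ltnW km))).
Qed.

(* If [m = 1] the link is empty and the whole complex is [L_1]. *)
Lemma wedge_one : m = 1%N ->
  exists j, heqv R (set0 : set unit) (poly (subst_complex K L)) (fun=> b None)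
    (wedge_set m) j.
Proof.
move=> m1; have [i alli] : exists i : 'I_m, forall j, j = i.
  have m0 : (0 < m)%N by rewrite m1.
  exists (Ordinal m0) => j; apply: val_inj => /=.
  by have := ltn_ord j; move: (nat_of_ord j) => q; rewrite m1; case: q.
have pX : piece (Some i) = subst_complex K L.
  rewrite -(level_complexT K L hn) /piece (_ : (i : nat).+1 = m); last first.
    by have := ltn_ord i; move: (nat_of_ord i) => q; rewrite m1; case: q.
  apply/seteqP; split=> [s []//|s Xs]; split => //.
  rewrite (_ : s :\: block n i = finset.set0).
    by rewrite finset.setU0; exact: level_root.
  by apply/setP => w; rewrite !inE (alli (tag w)) eqxx.
have lev0 x : poly (lev 0) x -> x = dirac R (vroot i).
  move=> [x0 x1 [Xs h]].
  have xw w : w != vroot i -> x w = 0.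
    move=> wi; apply/eqP/negPn/negP => xw.
    have xs : w \in supp x by rewrite inE.
    have [//|wr] := h w xs.
    by move: wi; rewrite wr (alli (tag w)) eqxx.
  apply/funext => w; rewrite /dirac; case: eqP => [->|/eqP wi]; last by rewrite xw.
  by rewrite -x1 (bigD1 (vroot i)) //= big1 ?addr0 // => w' /xw.
exists (fun=> wedge_pt).
apply: (@heqv_homeo _ _ _ _ _ _ _ _ _ (set_slice (Some i) wedge_pt)
  (fun y => slice y (Some i))) => //.
- apply: (@ctson_set_slice _ _ (fun=> wedge_pt) id); first exact: ctson_cst.
  exact: ctson_id.
- by apply: ctson_slice; exact: ctson_id.
- move=> x Xx; split; last by rewrite slice_set eqxx.
  split.
  + move=> o; rewrite slice_set; case: eqP => [->|_]; first by rewrite pX.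
    exact: hb.
  + by exists (Some i) => o /negPf oi; rewrite slice_set oi.
  + by move=> l ml; have := ltn_ord l; rewrite ltnNge ml.
- move=> y [yQ _ _]; split; first by rewrite -pX; exact: yQ.
  apply: sliceE => o; rewrite slice_set; case: eqP => [->//|oi].
  case: o oi => [l|_]; first by rewrite (alli l).
  by rewrite slice_pt (lev0 _ (hb None)) (lev0 _ (yQ None)).
Qed.

End WedgeInduction.

(** * Continuity into realizations and wedges *)

Lemma ctson_set_type (S T : topologicalType) (A : set T) (B : set S)
    (f : S -> set_type A) :
  ctson B (fun x => set_val (f x)) -> ctson B f.
Proof.
move=> cf x Bx U [/= _ [[/= W oW <-]] /= Wf] /filterS; apply.
by apply: (cf x Bx W); exact: open_nbhs_nbhs.
Qed.

Lemma ctsonT (S T : topologicalType) (f : S -> T) :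
  ctson setT f <-> continuous f.
Proof.
split=> [cf x W nW|cf]; last exact: continuous_ctson.
have h : nbhs x [set y | setT y -> W (f y)] by exact: (cf x I W nW).
by apply: filterS h => y /= h; exact: h.
Qed.

Lemma within_ctson (S T : topologicalType) (A : set S) (f : S -> T) :
  ctson A f <-> {within A, continuous f}.
Proof. by rewrite subspace_continuousP. Qed.

Lemma realization_iso (R : realType) (A V : finType) (c : A -> V)
    (G : {set A}) (P : set {set A}) (Q : set {set V}) (x0 : realization R P) :
  {in G &, injective c} -> (forall s, P s -> s \subset G) ->
  (forall s, Q s -> s \subset [set c a | a in G]%SET) ->
  (forall s : {set A}, s \subset G -> P s <-> Q [set c a | a in s]%SET) ->
  exists (phi : realization R P -> {ptws V -> R})
         (psi : {ptws V -> R} -> realization R P),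
  [/\ continuous phi, forall x, polyhedron R Q (phi x),
      forall x, psi (phi x) = x,
      forall y, polyhedron R Q y -> phi (psi y) = y
    & ctson (polyhedron R Q) psi].
Proof.
move=> ci PG QG PQ.
have Pval (x : realization R P) : polyhedron R P (set_val x) by exact: set_valP.
(* The inverse has to be total on the ambient space; [x0] is a default value off the polyhedron. *)
pose psi y : realization R P :=
  if pselect (polyhedron R P (pull c G y)) is left h then to_realization h
  else x0.
have psiE y : polyhedron R Q y -> set_val (psi y) = pull c G y.
  move=> Qy; rewrite /psi; case: pselect => [h|[]]; first by rewrite set_valE.
  exact: (pull_polyhedron ci QG PQ).
exists (fun x => push c (set_val x)), psi.
have hpush x := push_polyhedron PG PQ (Pval x).
split => //.
- apply/ctsonT; apply: (ctson_comp (B := setT) (f := set_val)) => //.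
    exact/ctsonT/set_val_continuous.
  exact: ctson_push.
- move=> x; apply: val_inj; rewrite -!set_valE psiE //.
  by rewrite (pushK ci PG).
- by move=> y Qy; rewrite psiE // (pullK ci QG).
- apply: ctson_set_type; apply: (@eq_ctson _ _ _ (pull c G)).
    by move=> y; rewrite inE => Qy; rewrite psiE.
  exact: ctson_pull.
Qed.

Lemma homotopic_clamp (R : realType) (X Y : topologicalType) (f g : X -> Y)
    (H : R * X -> Y) :
  ctson (@unitI R `*` [set: X]) H ->
  (forall x, H (0, x) = f x) -> (forall x, H (1, x) = g x) -> homotopic R f g.
Proof.
by move=> cH H0 H1; exists H; split => //; apply/within_ctson.
Qed.

Section WedgeContinuity.
Variables (I : finType) (X : I -> topologicalType) (p : forall i, X i).
Hypothesis clp : forall i, closed [set p i].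

(** A finite wedge at closed points carries the topology induced from the product
    ([wedge_prod_open]), so continuity can be tested on coordinates. *)
Lemma ctson_wedge (T : topologicalType) (A : set T) (f : T -> wedge p) :
  (forall i, ctson A (fun x => wedge_prod (f x) i)) -> ctson A f.
Proof.
move=> cf x Ax W nW.
have cf' : ctson A (fun x => wedge_prod (f x)) by exact: ctson_prod.
have := wedge_prod_open (@finite_finset I setT) clp nW.
rewrite /nbhs /= -nbhs_subspace_in; last by exists (f x).
move=> h.
have h2 : nbhs x [set y | A y -> range (@wedge_prod _ _ p) (wedge_prod (f y)) ->
    (@wedge_prod _ _ p @` W) (wedge_prod (f y))] by exact: (cf' x Ax _ h).
suff : nbhs x [set y | A y -> W (f y)] by [].
apply: filterS h2 => y /= h2 Ay.
have [|z Wz /wedge_prod_inj <- //] := h2 Ay.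
by exists (f y).
Qed.

Lemma wedge_prod_lift i (x : X i) :
  wedge_prod (wedge_lift p x) = dfwith p i x.
Proof. by rewrite /wedge_prod wedge_lift_funE //; exact: wedge_prod_pointE. Qed.

Lemma wedge_prod_away (z : wedge p) :
  exists i, forall j, j != i -> wedge_prod z j = p j.
Proof.
have : (\bigcup_i (@wedge_lift _ _ p i) @` setT) z by rewrite wedgeTE.
move=> [i _ [x _ <-]]; exists i => j ji.
by rewrite wedge_prod_lift dfwithout // eq_sym.
Qed.

End WedgeContinuity.

(** * Transfer to realizations and to the quotient wedge *)

Section Assembly.
Variables (R : realType) (m : nat) (n : 'I_m -> nat)
  (K : set {set 'I_m}) (L : forall i : 'I_m, set {set 'I_(n i)})
  (hn : forall i : 'I_m, (0 < n i)%N).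
Arguments L : clear implicits.
Hypotheses (hK : simplicial_complex K)
  (hL : forall i : 'I_m, simplicial_complex (L i)).
Local Notation V := {i : 'I_m & 'I_(n i)}.
Local Notation T := {ptws V -> R}.
Local Notation J := (option 'I_m).
Local Notation U := {ptws (J * V) -> R}.
Local Notation poly := (polyhedron R).
Local Notation lev := (level_complex K L hn).
Local Notation piece := (piece K L hn).
Local Notation summand := (wedge_summand R K L hn).

Let root_inj : {in [set: 'I_m]%SET &, injective (vroot hn)}.
Proof. by move=> i j _ _ /(congr1 tag). Qed.

Let root_sub (s : {set 'I_m}) : K s -> s \subset [set: 'I_m]%SET.
Proof. by move=> _; exact: finset.subsetT. Qed.

Let root_sur s : lev 0 s -> s \subset [set vroot hn a | a in [set: 'I_m]]%SET.
Proof.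
move=> [_ h]; apply/fintype.subsetP => w /h [//|->].
by apply: imset_f; rewrite inE.
Qed.

Let root_complex (s : {set 'I_m}) : s \subset [set: 'I_m]%SET ->
  K s <-> lev 0 [set vroot hn a | a in s]%SET.
Proof.
move=> _; have [_ _ _ _ h] := coding0 hn hK hL.
split=> [/h Xs|[/h //]]; split => // w /imsetP[a _ ->]; by right.
Qed.

Lemma path_lev0 : connected [set: realization R K] ->
  forall x y, poly (lev 0) x -> poly (lev 0) y -> path_in R (poly (lev 0)) x y.
Proof.
move=> cK x y lx ly; rewrite -(pullK root_inj root_sur lx).
rewrite -(pullK root_inj root_sur ly).
apply: (path_in_image (A := poly K) (f := push (vroot hn))).
- exact: ctson_push.
- by move=> z; apply: (push_polyhedron root_sub root_complex).
- apply: connected_path_in => //; first by case: hK.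
    exact: (pull_polyhedron root_inj root_sur root_complex).
  exact: (pull_polyhedron root_inj root_sur root_complex).
Qed.

(** Links each summand of the statement, whose vertices are nested sigma types, with the subcomplex
    of X that codes it; [p] serves as the default value of [psi]. *)
Lemma summand_iso (o : J) (p : summand o) :
  exists (phi : summand o -> T) (psi : T -> summand o),
  [/\ continuous phi, forall x, poly (piece o) (phi x),
      forall x, psi (phi x) = x,
      forall y, poly (piece o) y -> phi (psi y) = y
    & ctson (poly (piece o)) psi].
Proof.
case: o p => [i|] p; last first.
  exact: (realization_iso p root_inj root_sub root_sur root_complex).
have [code hcode] := iter_coding hn hK hL (ltnW (ltn_ord i)).
apply: (realization_iso p (join_code_inj hcode)).
- exact: join_sub.
- exact: join_code_sur hcode.
- exact: join_code_complex hcode.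
Qed.

Variable p : forall o, summand o.
Variables (phi : forall o, summand o -> T) (psi : forall o, T -> summand o).
Hypotheses (cphi : forall o, continuous (@phi o))
  (phiP : forall o x, poly (piece o) (@phi o x))
  (phiK : forall o x, psi o (@phi o x) = x)
  (psiK : forall o y, poly (piece o) y -> phi (psi o y) = y)
  (cpsi : forall o, ctson (poly (piece o)) (psi o)).

Definition base_image (o : J) : T := phi (p o).
Local Notation b := base_image.
Local Notation W := (wedge_set K L hn b m).

Let clp o : closed [set p o].
Proof.
rewrite -openC openE => x /= xp.
have [v hv] : exists v, phi x v != b o v.
  apply: contrapT => h; apply: xp; rewrite -[x]phiK -[p o]phiK; congr psi.
  by apply/funext => v; apply/eqP/negPn/negP => hv; apply: h; exists v.
have : nbhs x (@phi o @^-1` [set y : T | y v != b o v]).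
  apply: cphi; apply: (@proj_continuous V (fun=> R) v (phi x) [set r | r != b o v]).
  by apply: open_nbhs_nbhs; split => //; exact: open_neq.
by apply: filterS => y /= yv yp; move: yv; rewrite yp eqxx.
Qed.

Definition of_wedge (z : wedge p) : U := fun q => phi (wedge_prod z q.1) q.2.

(** On the wedge the index is ambiguous only at the wedge point, where all choices give the same
    result. Continuity cannot be read off this choice; it comes from [to_wedge_prod], whose formula
    does not mention the index. *)
Definition to_wedge (w : U) : wedge p :=
  let o := xget None [set o | forall o', o' != o -> slice w o' = b o'] in
  wedge_lift p (psi o (slice w o)).

Lemma of_wedgeP z : W (of_wedge z).
Proof.
split=> [o||i mi]; first exact: (phiP (wedge_prod z o)).
  have [o ho] := wedge_prod_away z.
  exists o => o' /ho e; apply/funext => v.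
  by rewrite /slice /of_wedge /= e.
by have := ltn_ord i; rewrite ltnNge mi.
Qed.

Lemma to_wedge_prod w o : W w -> wedge_prod (to_wedge w) o = psi o (slice w o).
Proof.
move=> [_ [o1 ho1] _]; rewrite /to_wedge wedge_prod_lift.
case: xgetP => [o0 _ /= h|/(_ o1)//].
have [<-|ne] := eqVneq o0 o; first by rewrite dfwithin.
rewrite dfwithout //.
by rewrite -[LHS]phiK h // eq_sym.
Qed.

Lemma of_wedgeK z : to_wedge (of_wedge z) = z.
Proof.
apply: wedge_prod_inj; apply: functional_extensionality_dep => o.
rewrite to_wedge_prod; last exact: of_wedgeP.
exact: (phiK (wedge_prod z o)).
Qed.

Lemma to_wedgeK w : W w -> of_wedge (to_wedge w) = w.
Proof.
move=> Ww; apply/funext => -[o v]; rewrite /of_wedge to_wedge_prod //.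
by have [h _ _] := Ww; rewrite psiK.
Qed.

Lemma of_wedge_cts : continuous of_wedge.
Proof.
apply/ctsonT; apply: ctson_prod => -[o v].
apply: (@ctson_coord _ R V _ (fun z : wedge p => phi (wedge_prod z o))).
apply/ctsonT => z; apply: continuous_comp; last exact: cphi.
apply: (@continuous_comp _ _ _ (@wedge_prod _ _ p) (fun y : prod_topology _ => y o)).
  exact: wedge_prod_continuous.
exact: proj_continuous.
Qed.

Lemma to_wedge_cts : ctson W to_wedge.
Proof.
apply: ctson_wedge => // o.
apply: (@eq_ctson _ _ _ (fun w => psi o (slice w o))).
  by move=> w; rewrite inE => Ww; rewrite to_wedge_prod.
apply: (ctson_comp (B := poly (piece o)) (f := fun w : U => slice w o)) => //.
  by move=> w [].
apply: ctson_prod => v.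
exact: (@ctson_coord _ R (J * V)%type _ id (o, v) (@ctson_id _ _)).
Qed.

Lemma wedge_equivalence : connected [set: realization R K] ->
  homotopy_equivalent R (realization R (subst_complex K L)) (wedge p).
Proof.
move=> cK; set X := subst_complex K L.
have [f [g [[cf cg fW gX] gf fg]]] : exists (f : T -> U) (g : U -> T),
    [/\ [/\ ctson (poly X) f, ctson W g, forall x, poly X x -> W (f x)
          & forall y, W y -> poly X (g y)],
        homot R (poly X) (poly X) set0 (fun x => g (f x)) id
      & homot R W W set0 (fun y => f (g y)) id].
  have hb o : poly (piece o) (b o) by exact: phiP.
  have [m1|m1] := ltnP 1 m.
    have [f [g [h _ gf fg]]] := wedge_induction hK hL hb m1 cK (path_lev0 cK).
    by exists f, g; split => //; [exact: homot_subP gf|exact: homot_subP fg].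
  have m0 : m = 1%N.
    apply/eqP; rewrite eqn_leq m1 /= lt0n; apply/negP => /eqP m0.
    (* The base point rules out m = 0: without vertices the coordinates could not sum to 1. *)
    have [_ + _] : poly K (set_val (p None)) by exact: set_valP.
    rewrite big1 => [/eqP|[i im]]; first by rewrite eq_sym oner_eq0.
    by exfalso; move: im; rewrite m0.
  have [j [f [g [h _ gf fg]]]] := wedge_one hK hL hb m0.
  by exists f, g; split => //; [exact: homot_subP gf|exact: homot_subP fg].
(* The homotopies are controlled only for times in [0, 1], while a map into a realization needs its
   membership proof at every real time. *)
pose cl (t : R) := Num.max 0 (Num.min 1 t).
have clI t : unitI (cl t).
  by rewrite /unitI /cl /= le_max lexx ge_max ler01 ge_min lexx.
have cl0 : cl 0 = 0 by rewrite /cl min_r // max_l.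
have cl1 : cl 1 = 1 by rewrite /cl min_l // max_r.
have ccl (S : topologicalType) (A : set S) (h : S -> R) :
    ctson A h -> ctson A (fun x => cl (h x)) by move=> ch; rewrite /cl; ctson_tac.
have Xval (x : realization R X) : poly X (set_val x) by exact: set_valP.
have cval : ctson setT (set_val : realization R X -> T).
  exact/ctsonT/set_val_continuous.
have val_inj' (x y : realization R X) : set_val x = set_val y -> x = y.
  by rewrite !set_valE => /val_inj.
have cof (A : set (wedge p)) : ctson A of_wedge.
  by apply: continuous_ctson; exact: of_wedge_cts.
exists (fun x => to_wedge (f (set_val x))),
  (fun z => to_realization (gX _ (of_wedgeP z))); split.
- apply/ctsonT; apply: (ctson_comp (B := W)) to_wedge_cts.
    by move=> x _; exact/fW/Xval.
  by apply: (ctson_comp (B := poly X)) cf.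
- apply/ctsonT; apply: ctson_set_type.
  apply: (@eq_ctson _ _ _ (fun z => g (of_wedge z))).
    by move=> z _; rewrite to_realizationK.
  by apply: (ctson_comp (B := W)) cg => // z _; exact: of_wedgeP.
- have [H [cH HB H0 H1 _]] := gf.
  apply: (@homotopic_clamp _ _ _ _ _
    (fun z => to_realization (HB _ _ (clI z.1) (Xval z.2)))).
  + apply: ctson_set_type.
    apply: (@eq_ctson _ _ _ (fun z : R * realization R X => H (cl z.1, set_val z.2))).
      by move=> z _; rewrite to_realizationK.
    apply: (ctson_comp (f := fun z : R * realization R X =>
      (cl z.1, set_val z.2)) _ _ cH).
      by move=> z _; split; [exact: clI|exact: Xval].
    apply: ctson_pair; first by apply: ccl; exact: ctson_fst.
    by apply: (ctson_comp (f := snd)) cval => //; exact: ctson_snd.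
  + move=> x; apply: val_inj'; rewrite !to_realizationK /= cl0 H0; last exact: Xval.
    by rewrite to_wedgeK //; exact/fW/Xval.
  + by move=> x; apply: val_inj'; rewrite to_realizationK /= cl1 H1.
- have [H [cH HB H0 H1 _]] := fg.
  apply: (@homotopic_clamp _ _ _ _ _
    (fun z => to_wedge (H (cl z.1, of_wedge z.2)))).
  + apply: (ctson_comp (B := W)) to_wedge_cts.
      by move=> z _; apply: HB => //; exact: of_wedgeP.
    apply: (ctson_comp (f := fun z : R * wedge p => (cl z.1, of_wedge z.2)) _ _ cH).
      by move=> z _; split; [exact: clI|exact: of_wedgeP].
    apply: ctson_pair; first by apply: ccl; exact: ctson_fst.
    by apply: (ctson_comp (f := snd) (B := setT)) => //; exact: ctson_snd.
  + move=> z /=; rewrite cl0 H0; last exact: of_wedgeP.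
    by rewrite to_realizationK.
  + by move=> z /=; rewrite cl1 H1 ?of_wedgeK //; exact: of_wedgeP.
Qed.

End Assembly.

Theorem theorem6p2p1 (R : realType) (m : nat) (n : 'I_m -> nat)
    (K : set {set 'I_m}) (L : forall i : 'I_m, set {set 'I_(n i)})
    (hn : forall i : 'I_m, (0 < n i)%N)
    (hK : simplicial_complex K)
    (hL : forall i : 'I_m, simplicial_complex (L i))
    (hconn : connected [set: realization R K])
    (p : forall o : option 'I_m, wedge_summand R K L hn o) :
  homotopy_equivalent R
    (realization R (subst_complex K L))
    (wedge p).
Proof.
pose iso o := cid (summand_iso hK hL (p o)).
pose iso' o := cid (projT2 (iso o)).
apply: (@wedge_equivalence R m n K L hn hK hL p
  (fun o => projT1 (iso o)) (fun o => projT1 (iso' o))) => //.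
- by move=> o; have [] := projT2 (iso' o).
- by move=> o; have [] := projT2 (iso' o).
- by move=> o; have [] := projT2 (iso' o).
- by move=> o; have [] := projT2 (iso' o).
- by move=> o; have [] := projT2 (iso' o).
Qed.
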